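(* Let $\kappa \le 0$, let $X$ be a CBB$(\kappa)$ space, let $Y$ be a complete CAT$(\kappa)$ space and let $A \subseteq X$ be nonempty. Then the multivalued mapping $\Phi : \mathcal{N}(A,Y) \to \mathcal{P}(\mathcal{N}(X,Y))$, which assigns to each $f \in \mathcal{N}(A,Y)$ the set of all $f' \in \mathcal{N}(X,Y)$ with $f'|_A = f$, is lower semi-continuous (with respect to the supremum metrics).
   Context: A geodesic space is a metric space in which any two points are joined by an isometric image of a real interval (a geodesic segment). For $\kappa\le 0$, $M^2_\kappa$ denotes the complete simply connected surface of constant curvature $\kappa$. A geodesic space is CAT$(\kappa)$ if for every geodesic triangle and its comparison triangle in $M^2_\kappa$ (same side lengths), distances between points on the triangle are $\le$ the distances between corresponding comparison points; it is CBB$(\kappa)$ (curvature bounded below by $\kappa$ in the sense of Alexandrov) if every geodesic triangle satisfies the reversed inequality ($\ge$). For metric spaces $A$, $Y$, $\mathcal{N}(A,Y)$ denotes the set of bounded nonexpansive ($1$-Lipschitz) mappings $A\to Y$, endowed with the supremum metric $d_\infty(f,g)=\sup_{x\in A} d_Y(f(x),g(x))$. $\mathcal{P}(C)$ denotes the family of subsets of $C$. A multivalued map $\Gamma: U\to\mathcal{P}(Z)$ between topological spaces is lower semi-continuous if for every open $V\subseteq Z$ the set $\{u\in U:\Gamma(u)\cap V\neq\emptyset\}$ is open. *)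

(* Defs.v *)
From Stdlib Require Import Reals.
From Coquelicot Require Import Coquelicot.
Open Scope R_scope.

Record MetricSpace := {
  carrier :> Type;
  mdist : carrier -> carrier -> R;
  mdist_eq0 : forall x y, mdist x y = 0 <-> x = y;
  mdist_sym : forall x y, mdist x y = mdist y x;
  mdist_tri : forall x y z, mdist x z <= mdist x y + mdist y z
}.
Arguments mdist {m} _ _.

Definition complete (Y : MetricSpace) : Prop :=
  forall u : nat -> Y,
    (forall e, 0 < e -> exists N, forall m n, (N <= m)%nat -> (N <= n)%nat ->
        mdist (u m) (u n) < e) ->
    exists l : Y, forall e, 0 < e -> exists N, forall n, (N <= n)%nat -> mdist (u n) l < e.

Definition geodesic_seg {X : MetricSpace} (a b : X) (g : R -> X) : Prop :=
  g 0 = a /\ g (mdist a b) = b /\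
  forall s t, 0 <= s <= mdist a b -> 0 <= t <= mdist a b -> mdist (g s) (g t) = Rabs (s - t).

Definition geodesic_space (X : MetricSpace) : Prop :=
  forall a b : X, exists g : R -> X, geodesic_seg a b g.

(** The model plane M^2_k, for k <= 0, on the carrier R*R.
    k = 0 : Euclidean plane.
    k < 0 : hyperboloid model {x0 > 0, -x0^2+x1^2+x2^2 = 1/k} of the hyperbolic
            plane of curvature k, parametrised by (x1,x2) in R^2 with
            x0 = sqrt(x1^2+x2^2-1/k); distance (1/sqrt(-k)) arcosh(k <x,y>_Mink). *)
Definition arcosh (u : R) : R := ln (u + sqrt (u ^ 2 - 1)).
Definition hx0 (k : R) (p : R * R) : R := sqrt (fst p ^ 2 + snd p ^ 2 - / k).
Definition Mdist (k : R) (p q : R * R) : R :=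
  if Rlt_dec k 0 then
    / sqrt (- k) * arcosh (k * (- hx0 k p * hx0 k q + fst p * fst q + snd p * snd q))
  else sqrt ((fst p - fst q) ^ 2 + (snd p - snd q) ^ 2).

(** x (on the geodesic g from a to b in X) and xb (in M^2_k) correspond:
    x = g s and xb is the point of the segment [ab, bb] at distance s from ab. *)
Definition corr (k : R) {X : MetricSpace} (a b : X) (g : R -> X) (ab bb : R * R)
    (x : X) (xb : R * R) : Prop :=
  exists s, 0 <= s <= mdist a b /\ x = g s /\
    Mdist k ab xb = s /\ Mdist k xb bb = Mdist k ab bb - s.

Definition tri_corr (k : R) {X : MetricSpace} (p q r : X) (g1 g2 g3 : R -> X)
    (pb qb rb : R * R) (x : X) (xb : R * R) : Prop :=
  corr k p q g1 pb qb x xb \/ corr k q r g2 qb rb x xb \/ corr k r p g3 rb pb x xb.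

Definition comparison_ineq (k : R) (X : MetricSpace) (cmp : R -> R -> Prop) : Prop :=
  forall (p q r : X) (g1 g2 g3 : R -> X),
    geodesic_seg p q g1 -> geodesic_seg q r g2 -> geodesic_seg r p g3 ->
    forall pb qb rb : R * R,
      Mdist k pb qb = mdist p q -> Mdist k qb rb = mdist q r -> Mdist k rb pb = mdist r p ->
      forall (x y : X) (xb yb : R * R),
        tri_corr k p q r g1 g2 g3 pb qb rb x xb ->
        tri_corr k p q r g1 g2 g3 pb qb rb y yb ->
        cmp (mdist x y) (Mdist k xb yb).

Definition CAT (k : R) (X : MetricSpace) : Prop :=
  geodesic_space X /\ comparison_ineq k X Rle.

Definition CBB (k : R) (X : MetricSpace) : Prop :=
  geodesic_space X /\ comparison_ineq k X Rge.

Definition nonexpansive {T : Type} (dT : T -> T -> R) {Y : MetricSpace} (f : T -> Y) :=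
  forall s t, mdist (f s) (f t) <= dT s t.
Definition bounded_map {T : Type} {Y : MetricSpace} (f : T -> Y) :=
  exists B, forall s t, mdist (f s) (f t) <= B.
Definition Nmap {T : Type} (dT : T -> T -> R) (Y : MetricSpace) : Type :=
  { f : T -> Y | nonexpansive dT f /\ bounded_map f }.

Definition dsup {T : Type} {dT : T -> T -> R} {Y : MetricSpace} (f g : Nmap dT Y) : R :=
  real (Lub_Rbar (fun r => exists t : T, r = mdist (proj1_sig f t) (proj1_sig g t))).

Definition sub (X : MetricSpace) (A : X -> Prop) : Type := { x : X | A x }.
Definition dsub {X : MetricSpace} (A : X -> Prop) (a b : sub X A) : R :=
  mdist (proj1_sig a) (proj1_sig b).

Definition NA (X : MetricSpace) (A : X -> Prop) (Y : MetricSpace) : Type :=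
  Nmap (dsub A) Y.
Definition NX (X Y : MetricSpace) : Type := Nmap (@mdist X) Y.

Definition is_open {T : Type} (d : T -> T -> R) (U : T -> Prop) : Prop :=
  forall u, U u -> exists e, 0 < e /\ forall v, d u v < e -> U v.

Definition lower_semicontinuous {U Z : Type} (dU : U -> U -> R) (dZ : Z -> Z -> R)
    (Gamma : U -> Z -> Prop) : Prop :=
  forall V : Z -> Prop, is_open dZ V -> is_open dU (fun u => exists z, Gamma u z /\ V z).

Definition Phi {X Y : MetricSpace} (A : X -> Prop) (f : NA X A Y) (f' : NX X Y) : Prop :=
  forall a : sub X A, proj1_sig f' (proj1_sig a) = proj1_sig f a.

(* Main.v *)
(** Put [e = - k]. In a CBB(k) space, any weighted points [a_i] and any base point [x] satisfy
    [sum_ij w_i w_j (cosh d(x,a_i) cosh d(x,a_j) - cosh d(a_i,a_j)) >= 0] (for [k = -1]): after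
    rescaling towards [x] this says that a sum of tangent vectors has nonnegative square, and
    one merges the vectors two at a time through midpoints. In a complete CAT(k) space the
    reversed inequality holds at the minimizer of a penalty that measures how much a point
    misses finitely many balls, with the penalty's derivatives as weights. Comparing the two
    yields Kirszbraun's intersection property for balls.

    To keep the extension close to a given map [F], the property is applied to the balls around
    the values of [g] together with balls around all values of [F], the latter with radii
    [d'] given by [cosh d' = c cosh d] (for [k = 0], [d'^2 = d^2 + h^2], i.e. distances in
    [X x R]). The required inequality survives the passage from [d] to [d'], maps [g] on [A]
    close to [F] satisfy the constraints for [c] close to [1], and at [d = 0] the constraint
    bounds the distance of the extension to [F]. One-point extensions and Zorn's lemma
    conclude. *)

Require Import Defs.
From Stdlib Require Import Reals Lra Psatz List IndefiniteDescription.
From Coquelicot Require Import Coquelicot.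
From mathcomp Require classical_sets.
Open Scope R_scope.

(** * Trigonometry of constant curvature [- e] *)

Definition sn (e t : R) : R :=
  if Req_EM_T e 0 then t else sinh (sqrt e * t) / sqrt e.

(** The antiderivative of [sn e] that vanishes at 0. Unlike the hyperbolic cosine it still carries
    the distance at [e = 0], so one computation covers the flat and the hyperbolic case. *)
Definition md (e t : R) : R :=
  if Req_EM_T e 0 then t ^ 2 / 2 else (cosh (sqrt e * t) - 1) / e.

Definition cs (e t : R) : R := 1 + e * md e t.

Lemma cosh_sqr x : cosh x ^ 2 = 1 + sinh x ^ 2.
Proof.
  unfold cosh, sinh. rewrite exp_Ropp. field. apply Rgt_not_eq, exp_pos.
Qed.

Lemma cosh_plus x y : cosh (x + y) = cosh x * cosh y + sinh x * sinh y.
Proof.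
  unfold cosh, sinh. rewrite !exp_Ropp, exp_plus. field.
  split; apply Rgt_not_eq, exp_pos.
Qed.

Lemma sinh_plus x y : sinh (x + y) = sinh x * cosh y + cosh x * sinh y.
Proof.
  unfold cosh, sinh. rewrite !exp_Ropp, exp_plus. field.
  split; apply Rgt_not_eq, exp_pos.
Qed.

Lemma sqrt_pos_sqr e : 0 <= e -> e <> 0 -> 0 < sqrt e /\ e = sqrt e * sqrt e.
Proof.
  intros h n. split; [apply sqrt_lt_R0; lra | now rewrite sqrt_sqrt].
Qed.

(** Away from [e = 0] the parameter becomes [s * s] with [s = sqrt e > 0], which lets [field] clear
    the denominators. *)
Ltac trig e :=
  unfold md, sn; destruct (Req_EM_T e 0) as [He0 | He0];
  [ subst e
  | let H1 := fresh "Hs" in let H2 := fresh "He2" in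
    destruct (sqrt_pos_sqr e) as [H1 H2]; [assumption | assumption | ];
    let s := fresh "s" in set (s := sqrt e) in *; clearbody s; subst e ].

Lemma sn_0 e : sn e 0 = 0.
Proof.
  unfold sn. destruct (Req_EM_T e 0); [reflexivity|].
  rewrite Rmult_0_r, sinh_0. unfold Rdiv; ring.
Qed.

Lemma md_0 e : md e 0 = 0.
Proof.
  unfold md. destruct (Req_EM_T e 0); [field|].
  rewrite Rmult_0_r, cosh_0. unfold Rdiv; ring.
Qed.

Lemma sn_opp e t : sn e (- t) = - sn e t.
Proof.
  unfold sn. destruct (Req_EM_T e 0); [reflexivity|].
  rewrite <- Ropp_mult_distr_r. unfold sinh. rewrite Ropp_involutive. unfold Rdiv; ring.
Qed.

Lemma md_opp e t : md e (- t) = md e t.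
Proof.
  unfold md. destruct (Req_EM_T e 0); [field|].
  rewrite <- Ropp_mult_distr_r. unfold cosh. rewrite Ropp_involutive. unfold Rdiv; ring.
Qed.

Lemma sn_sqr e t : 0 <= e -> sn e t ^ 2 = 2 * md e t + e * md e t ^ 2.
Proof.
  intros h. trig e; [field|].
  replace ((sinh (s * t) / s) ^ 2) with (sinh (s * t) ^ 2 / (s * s)) by (field; lra).
  replace (sinh (s * t) ^ 2) with (cosh (s * t) ^ 2 - 1) by (rewrite cosh_sqr; ring).
  field; lra.
Qed.

Lemma md_plus e a b : 0 <= e ->
  md e (a + b) = md e a + md e b + e * md e a * md e b + sn e a * sn e b.
Proof.
  intros h. trig e; [field|].
  rewrite Rmult_plus_distr_l, cosh_plus. field; lra.
Qed.

Lemma sn_plus e a b : 0 <= e ->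
  sn e (a + b) = sn e a * cs e b + cs e a * sn e b.
Proof.
  intros h. unfold cs. trig e; [ring|].
  rewrite Rmult_plus_distr_l, sinh_plus. field; lra.
Qed.

Lemma sn_pos e t : 0 <= e -> 0 < t -> 0 < sn e t.
Proof.
  intros h ht. trig e; [exact ht|].
  apply Rdiv_lt_0_compat; [|exact Hs].
  rewrite <- sinh_0. apply sinh_lt. nra.
Qed.

Definition asn (e y : R) : R :=
  if Req_EM_T e 0 then y else arcsinh (y * sqrt e) / sqrt e.

Lemma sn_asn e y : 0 <= e -> sn e (asn e y) = y.
Proof.
  intros h. unfold asn. trig e; [reflexivity|].
  replace (s * (arcsinh (y * s) / s)) with (arcsinh (y * s)) by (field; lra).
  rewrite sinh_arcsinh. field; lra.
Qed.

Lemma md_continuity e : continuity (md e).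
Proof.
  unfold md. destruct (Req_EM_T e 0) as [h|h]; reg.
Qed.

Lemma sn_nonneg e t : 0 <= e -> 0 <= t -> 0 <= sn e t.
Proof.
  intros h [ht | <-]; [left; now apply sn_pos | rewrite sn_0; lra].
Qed.

Lemma md_double e t : 0 <= e -> md e (2 * t) = 4 * md e t + 2 * e * md e t ^ 2.
Proof.
  intros h. replace (2 * t) with (t + t) by ring.
  rewrite md_plus by exact h.
  replace (sn e t * sn e t) with (sn e t ^ 2) by ring. rewrite sn_sqr by exact h. ring.
Qed.

(** Half-angle formula. It reduces sign, monotonicity and surjectivity of [md] to properties of
    [sn]. *)
Lemma md_half e t : 0 <= e -> md e t = 2 * sn e (t / 2) ^ 2.
Proof.
  intros h. rewrite sn_sqr by exact h.
  replace t with (2 * (t / 2)) at 1 by field. rewrite md_double by exact h. ring.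
Qed.

Lemma md_nonneg e t : 0 <= e -> 0 <= md e t.
Proof. intros h. rewrite md_half by exact h. nra. Qed.

Lemma cs_ge1 e t : 0 <= e -> 1 <= cs e t.
Proof. intros h. unfold cs. pose proof (md_nonneg e t h). nra. Qed.

Lemma sn_double e t : 0 <= e -> sn e (2 * t) = 2 * cs e t * sn e t.
Proof.
  intros h. replace (2 * t) with (t + t) by ring. rewrite sn_plus by exact h. ring.
Qed.

Lemma sn_le e a b : 0 <= e -> 0 <= a <= b -> sn e a <= sn e b.
Proof.
  intros h [ha hab]. replace b with (a + (b - a)) by ring.
  rewrite sn_plus by exact h.
  pose proof (cs_ge1 e (b - a) h). pose proof (cs_ge1 e a h).
  pose proof (sn_nonneg e a h ha). pose proof (sn_nonneg e (b - a) h ltac:(lra)). nra.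
Qed.

Lemma md_le e a b : 0 <= e -> 0 <= a <= b -> md e a <= md e b.
Proof.
  intros h [ha hab]. rewrite !md_half by exact h.
  pose proof (sn_le e (a / 2) (b / 2) h ltac:(lra)).
  pose proof (sn_nonneg e (a / 2) h ltac:(lra)). nra.
Qed.

Lemma sn_lt e a b : 0 <= e -> 0 <= a < b -> sn e a < sn e b.
Proof.
  intros h [ha hab]. replace b with (a + (b - a)) by ring.
  rewrite sn_plus by exact h.
  pose proof (cs_ge1 e (b - a) h). pose proof (cs_ge1 e a h).
  pose proof (sn_nonneg e a h ha). pose proof (sn_pos e (b - a) h ltac:(lra)). nra.
Qed.

Lemma sn_le_inv e a b : 0 <= e -> 0 <= b -> sn e a <= sn e b -> a <= b.
Proof.
  intros h hb H. destruct (Rle_or_lt a b) as [|Hlt]; [assumption|].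
  pose proof (sn_lt e b a h (conj hb Hlt)). lra.
Qed.

Lemma md_lt e a b : 0 <= e -> 0 <= a < b -> md e a < md e b.
Proof.
  intros h [ha hab]. rewrite !md_half by exact h.
  pose proof (sn_lt e (a / 2) (b / 2) h ltac:(lra)).
  pose proof (sn_nonneg e (a / 2) h ltac:(lra)). nra.
Qed.

Lemma md_le_inv e a b : 0 <= e -> 0 <= b -> md e a <= md e b -> a <= b.
Proof.
  intros h hb H. destruct (Rle_or_lt a b) as [|Hlt]; [assumption|].
  pose proof (md_lt e b a h (conj hb Hlt)). lra.
Qed.

Lemma asn_nonneg e y : 0 <= e -> 0 <= y -> 0 <= asn e y.
Proof.
  intros h hy. destruct (Rle_or_lt 0 (asn e y)) as [|Hlt]; [assumption|].
  pose proof (sn_pos e (- asn e y) h ltac:(lra)) as H.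
  rewrite sn_opp, sn_asn in H by exact h. lra.
Qed.

Lemma md_surj e y : 0 <= e -> 0 <= y -> exists t, 0 <= t /\ md e t = y.
Proof.
  intros h hy. exists (2 * asn e (sqrt (y / 2))).
  pose proof (asn_nonneg e (sqrt (y / 2)) h (sqrt_pos _)). split; [lra|].
  rewrite md_half by exact h.
  replace (2 * asn e (sqrt (y / 2)) / 2) with (asn e (sqrt (y / 2))) by field.
  rewrite sn_asn, pow2_sqrt by lra. field.
Qed.

Lemma sn_ge_id e t : 0 <= e -> 0 <= t -> t <= sn e t.
Proof.
  intros h ht. trig e; [lra|].
  enough (s * t <= sinh (s * t)).
  { apply (Rmult_le_reg_l s); [exact Hs|].
    replace (s * (sinh (s * t) / s)) with (sinh (s * t)) by (field; lra). exact H. }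
  assert (0 <= s * t) as hx by nra. generalize hx. generalize (s * t). clear. intros x hx.
  destruct hx as [hx | <-]; [|rewrite sinh_0; lra].
  destruct (MVT_cor2 sinh cosh 0 x hx) as (c & Hc & _).
  { intros; apply derivable_pt_lim_sinh. }
  rewrite sinh_0 in Hc.
  assert (1 <= cosh c). { pose proof (cosh_sqr c). assert (0 < cosh c).
    { unfold cosh. pose proof (exp_pos c). pose proof (exp_pos (- c)). lra. } nra. }
  nra.
Qed.

Lemma md_ge_sqr e t : 0 <= e -> 0 <= t -> t ^ 2 / 2 <= md e t.
Proof.
  intros h ht. rewrite md_half by exact h.
  pose proof (sn_ge_id e (t / 2) h ltac:(lra)). nra.
Qed.

(** Shows that [md] is of second order when a small parameter is prescribed as a value of [sn]. *)
Lemma md_le_sn_sqr e t : 0 <= e -> md e t <= sn e t ^ 2 / 2.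
Proof.
  intros h. rewrite sn_sqr by exact h. pose proof (pow2_ge_0 (md e t)). nra.
Qed.

(** Numerator of the cosine of the comparison angle, in curvature [- e], between sides of
    lengths [a] and [b] opposite to a side of length [d]; the denominator is
    [sn e a * sn e b]. *)
Definition ip (e a b d : R) : R := md e a + md e b + e * md e a * md e b - md e d.

(** By the addition formula equality holds for the degenerate triangle [d = |a - b|], and [md] is
    monotone. With [ip_ge], which treats [d = a + b], this puts comparison cosines between -1 and
    1. *)
Lemma ip_le e a b d : 0 <= e -> 0 <= d -> Rabs (a - b) <= d ->
  ip e a b d <= sn e a * sn e b.
Proof.
  intros h hd H.
  pose proof (md_le e _ _ h (conj (Rabs_pos (a - b)) H)) as H1.
  assert (md e (Rabs (a - b)) = md e (a + - b)) as H2.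
  { unfold Rabs. destruct (Rcase_abs (a - b)); [rewrite md_opp|]; reflexivity. }
  rewrite H2, md_plus, md_opp, sn_opp in H1 by exact h. unfold ip. lra.
Qed.

Lemma ip_ge e a b d : 0 <= e -> 0 <= d <= a + b -> - (sn e a * sn e b) <= ip e a b d.
Proof.
  intros h H. pose proof (md_le e _ _ h H) as H1.
  rewrite md_plus in H1 by exact h. unfold ip. lra.
Qed.

(** * Comparison triangles in the model plane *)

Lemma arcosh_cosh x : 0 <= x -> arcosh (cosh x) = x.
Proof.
  intros hx. unfold arcosh.
  replace (cosh x ^ 2 - 1) with (sinh x ^ 2) by (rewrite cosh_sqr; ring).
  rewrite sqrt_pow2.
  - replace (cosh x + sinh x) with (exp x) by (unfold cosh, sinh; field). apply ln_exp.
  - destruct hx as [hx | <-]; [|rewrite sinh_0; lra].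
    rewrite <- sinh_0. now apply Rlt_le, sinh_lt.
Qed.

Lemma cs_sqr e t : 0 <= e -> cs e t ^ 2 = 1 + e * sn e t ^ 2.
Proof. intros h. rewrite sn_sqr by exact h. unfold cs. ring. Qed.

Lemma cs_cosh e t : e <> 0 -> cs e t = cosh (sqrt e * t).
Proof.
  intros h. unfold cs, md. destruct (Req_EM_T e 0); [contradiction|]. field; exact h.
Qed.

Lemma hx0_polar k a u v : k < 0 -> u ^ 2 + v ^ 2 = 1 ->
  hx0 k (sn (- k) a * u, sn (- k) a * v) = cs (- k) a / sqrt (- k).
Proof.
  intros hk huv. unfold hx0; simpl fst; simpl snd.
  assert (0 < sqrt (- k)) as hs by (apply sqrt_lt_R0; lra).
  pose proof (cs_ge1 (- k) a ltac:(lra)) as hc.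
  rewrite <- (sqrt_pow2 (cs (- k) a / sqrt (- k))).
  - f_equal.
    replace ((cs (- k) a / sqrt (- k)) ^ 2) with (cs (- k) a ^ 2 / (sqrt (- k) * sqrt (- k)))
      by (field; lra).
    rewrite sqrt_sqrt, cs_sqr by lra.
    replace ((sn (- k) a * u) ^ 2 + (sn (- k) a * v) ^ 2)
      with (sn (- k) a ^ 2 * (u ^ 2 + v ^ 2)) by ring.
    rewrite huv. field; lra.
  - apply Rlt_le, Rdiv_lt_0_compat; lra.
Qed.

(** The points are given in polar coordinates about the origin, with radii [a], [b] and unit
    directions [(u, v)], [(u', v')]; the last hypothesis is the law of cosines. *)
Lemma Mdist_polar k a b u v u' v' d : k <= 0 ->
  u ^ 2 + v ^ 2 = 1 -> u' ^ 2 + v' ^ 2 = 1 -> 0 <= d ->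
  ip (- k) a b d = (u * u' + v * v') * (sn (- k) a * sn (- k) b) ->
  Mdist k (sn (- k) a * u, sn (- k) a * v) (sn (- k) b * u', sn (- k) b * v') = d.
Proof.
  intros hk huv huv' hd H. unfold Mdist. destruct (Rlt_dec k 0) as [hk' | hk'].
  - rewrite !hx0_polar by assumption. simpl fst; simpl snd.
    assert (0 < sqrt (- k)) as hs by (apply sqrt_lt_R0; lra).
    replace (k * _) with (cosh (sqrt (- k) * d)).
    + rewrite arcosh_cosh by nra. field; lra.
    + rewrite <- cs_cosh by lra.
      replace (- (cs (- k) a / sqrt (- k)) * (cs (- k) b / sqrt (- k)))
        with (- (cs (- k) a * cs (- k) b / (sqrt (- k) * sqrt (- k)))) by (field; lra).
      rewrite sqrt_sqrt by lra. unfold cs.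
      transitivity (1 + - k * (md (- k) a + md (- k) b + - k * md (- k) a * md (- k) b
                     - (u * u' + v * v') * (sn (- k) a * sn (- k) b))).
      * rewrite <- H. unfold ip. ring.
      * field; lra.
  - assert (k = 0) as -> by lra. rewrite Ropp_0 in *. simpl fst; simpl snd.
    unfold ip, md, sn in *. destruct (Req_EM_T 0 0); [|contradiction].
    rewrite <- (sqrt_pow2 d hd). f_equal.
    transitivity (a ^ 2 * (u ^ 2 + v ^ 2) + b ^ 2 * (u' ^ 2 + v' ^ 2)
                  - 2 * ((u * u' + v * v') * (a * b))); [ring|].
    rewrite huv, huv', <- H. field.
Qed.

(** The vertex [pb] is the origin, [qb] and [xb] lie on the first axis, and [rb] lies in the
    direction of the comparison angle. The final equation holds because the triangles [pb xb rb] and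
    [pb qb rb] share their angle at [pb]. The distance from [rb] to itself is recorded so that [rb]
    can serve as a point of a side. *)
Lemma comparison_triangle k l m n t : k <= 0 -> 0 <= l -> 0 <= m -> 0 <= n ->
  Rabs (l - n) <= m <= l + n -> 0 <= t <= l ->
  exists pb qb rb xb v,
    (Mdist k pb qb = l /\ Mdist k qb rb = m /\ Mdist k rb pb = n /\ Mdist k rb rb = 0) /\
    (Mdist k pb xb = t /\ Mdist k xb qb = l - t /\ Mdist k xb rb = v) /\
    0 <= v /\ sn (- k) l * ip (- k) t n v = sn (- k) t * ip (- k) l n m.
Proof.
  intros hk hl hm hn [H1 H2] ht. assert (0 <= - k) as he by lra.
  remember (- k) as e eqn:Ee.
  assert (exists c, -1 <= c <= 1 /\ ip e l n m = c * (sn e l * sn e n)) as (c & hc & Hc).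
  { pose proof (ip_le e l n m he hm H1). pose proof (ip_ge e l n m he (conj hm H2)).
    pose proof (sn_nonneg e l he hl). pose proof (sn_nonneg e n he hn).
    destruct (Req_dec (sn e l * sn e n) 0) as [Z | Z].
    (* In a degenerate triangle the two bounds force [ip] to vanish, so any cosine would do. *)
    - exists 1. split; lra.
    - assert (0 < sn e l * sn e n) as P by nra.
      exists (ip e l n m / (sn e l * sn e n)). split; [|field; split; intros Q; apply Z; rewrite Q; ring].
      split; [apply Rle_div_r | apply Rle_div_l]; lra. }
  pose (s := sqrt (1 - c ^ 2)).
  assert (c ^ 2 + s ^ 2 = 1) as hcs by (unfold s; rewrite pow2_sqrt; nra).
  assert (1 ^ 2 + 0 ^ 2 = 1) as h1 by ring.
  (* The law of cosines defines [v]. Its right-hand side is nonnegative, being smallest at [c = 1],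
     where it equals [md e (t - n)]. *)
  destruct (md_surj e (md e t + md e n + e * md e t * md e n - c * (sn e t * sn e n)) he)
    as (v & hv & Hv).
  { pose proof (md_nonneg e (t + - n) he) as P. rewrite md_plus, md_opp, sn_opp in P by exact he.
    pose proof (sn_nonneg e t he ltac:(lra)). pose proof (sn_nonneg e n he hn).
    assert (0 <= sn e t * sn e n) by nra. nra. }
  pose proof (sn_0 e) as S0. pose proof (md_0 e) as M0.
  exists (sn e 0 * 1, sn e 0 * 0), (sn e l * 1, sn e l * 0), (sn e n * c, sn e n * s),
    (sn e t * 1, sn e t * 0), v.
  subst e.
  repeat split; try exact hv; try (apply Mdist_polar; try assumption; try lra).
  - unfold ip. rewrite S0, M0. ring.
  - unfold ip. rewrite S0, M0. ring.
  - unfold ip. rewrite M0. pose proof (sn_sqr (- k) n he).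
    replace (c * c + s * s) with 1 by (rewrite <- hcs; ring). lra.
  - unfold ip. rewrite S0, M0. ring.
  - unfold ip. replace (l - t) with (l + - t) by ring.
    rewrite md_plus, md_opp, sn_opp by exact he. ring.
  - unfold ip. rewrite Hv. ring.
  - rewrite Hc. unfold ip. rewrite Hv. ring.
Qed.

(** * Hinge comparison in metric spaces *)

Lemma mdist_self {X : MetricSpace} (x : X) : mdist x x = 0.
Proof. now apply mdist_eq0. Qed.

Lemma mdist_nonneg {X : MetricSpace} (x y : X) : 0 <= mdist x y.
Proof.
  pose proof (mdist_tri X x y x) as H. rewrite mdist_self, (mdist_sym X y x) in H. lra.
Qed.

Lemma mdist_tri_abs {X : MetricSpace} (a b p : X) :
  Rabs (mdist a b - mdist a p) <= mdist b p <= mdist a b + mdist a p.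
Proof.
  pose proof (mdist_tri X a b p). pose proof (mdist_tri X a p b).
  pose proof (mdist_tri X b a p).
  rewrite (mdist_sym X p b) in *. rewrite (mdist_sym X b a) in *.
  split; [apply Rabs_le|]; lra.
Qed.

Definition pr (e : R) {X : MetricSpace} (x a b : X) : R :=
  ip e (mdist x a) (mdist x b) (mdist a b).

(** For [cmp := Rge] (resp. [Rle]) this says that the comparison angle at [a] between [p]
    and [g t] is nonincreasing (resp. nondecreasing) in [t]. *)
Definition hinge (e : R) (X : MetricSpace) (cmp : R -> R -> Prop) : Prop :=
  forall (a b p : X) g t, geodesic_seg a b g -> 0 <= t <= mdist a b ->
    cmp (sn e t * pr e a b p) (sn e (mdist a b) * pr e a (g t) p).

Lemma geodesic_dist {X : MetricSpace} (a b : X) g t : geodesic_seg a b g ->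
  0 <= t <= mdist a b -> mdist a (g t) = t /\ mdist (g t) b = mdist a b - t.
Proof.
  intros (H0 & H1 & H2) ht. split.
  - rewrite <- H0 at 1. rewrite H2 by lra. rewrite Rabs_minus_sym, Rabs_right; lra.
  - rewrite <- H1 at 1. rewrite H2 by lra. rewrite Rabs_minus_sym, Rabs_right; lra.
Qed.

(** The triangle comparison is used only for a point of one side and the opposite vertex; [v] is the
    corresponding distance in the model triangle. *)
Lemma comparison_dist k (X : MetricSpace) cmp : k <= 0 -> geodesic_space X ->
  comparison_ineq k X cmp ->
  forall (a b p : X) g t, geodesic_seg a b g -> 0 <= t <= mdist a b ->
  exists v, 0 <= v /\ cmp (mdist (g t) p) v /\
    sn (- k) (mdist a b) * ip (- k) t (mdist a p) v = sn (- k) t * pr (- k) a b p.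
Proof.
  intros hk hX H a b p g t hg ht.
  destruct (hX b p) as [g2 hg2]. destruct (hX p a) as [g3 hg3].
  destruct (comparison_triangle k (mdist a b) (mdist b p) (mdist a p) t hk
    (mdist_nonneg _ _) (mdist_nonneg _ _) (mdist_nonneg _ _) (mdist_tri_abs a b p) ht)
    as (pb & qb & rb & xb & v & (D1 & D2 & D3 & D4) & (E1 & E2 & E3) & hv & Hv).
  exists v. split; [exact hv|]. split; [|exact Hv].
  rewrite <- E3.
  apply (H a b p g g2 g3 hg hg2 hg3 pb qb rb); auto.
  - now rewrite (mdist_sym X p a).
  - left. exists t. repeat split; try lra.
  (* The vertex [p] is read as the far end of the second side. *)
  - right; left. exists (mdist b p).
    pose proof (mdist_nonneg b p). destruct hg2 as (_ & Hp & _).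
    repeat split; try lra. now symmetry.
Qed.

Lemma hinge_CBB k X : k <= 0 -> CBB k X -> hinge (- k) X Rge.
Proof.
  intros hk [hX H] a b p g t hg ht.
  destruct (comparison_dist k X Rge hk hX H a b p g t hg ht) as (v & hv & Hc & Hv).
  rewrite <- Hv. unfold pr. destruct (geodesic_dist a b g t hg ht) as [-> _].
  apply Rle_ge, Rmult_le_compat_l; [apply sn_nonneg; [lra | apply mdist_nonneg]|].
  unfold ip. pose proof (md_le (- k) v (mdist (g t) p) ltac:(lra) ltac:(lra)). lra.
Qed.

Lemma hinge_CAT k X : k <= 0 -> CAT k X -> hinge (- k) X Rle.
Proof.
  intros hk [hX H] a b p g t hg ht.
  destruct (comparison_dist k X Rle hk hX H a b p g t hg ht) as (v & hv & Hc & Hv).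
  rewrite <- Hv. unfold pr. destruct (geodesic_dist a b g t hg ht) as [-> _].
  apply Rmult_le_compat_l; [apply sn_nonneg; [lra | apply mdist_nonneg]|].
  unfold ip. pose proof (md_le (- k) (mdist (g t) p) v ltac:(lra)
    (conj (mdist_nonneg _ _) Hc)). lra.
Qed.

Lemma pr_sym e {X : MetricSpace} (x a b : X) : pr e x a b = pr e x b a.
Proof. unfold pr, ip. rewrite (mdist_sym X a b). ring. Qed.

Lemma pr_self e {X : MetricSpace} (x a : X) : 0 <= e -> pr e x a a = sn e (mdist x a) ^ 2.
Proof. intros h. unfold pr, ip. rewrite mdist_self, md_0, sn_sqr by exact h. ring. Qed.

Lemma pr_base e {X : MetricSpace} (x a p : X) : mdist x a = 0 -> pr e x a p = 0.
Proof.
  intros H. apply mdist_eq0 in H as <-. unfold pr, ip. rewrite mdist_self, md_0. ring.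
Qed.

Lemma pr_ge e {X : MetricSpace} (x a b : X) : 0 <= e ->
  - (sn e (mdist x a) * sn e (mdist x b)) <= pr e x a b.
Proof.
  intros h. apply ip_ge; [exact h|]. split; [apply mdist_nonneg | apply mdist_tri_abs].
Qed.

(** * Midpoint inequalities *)

Lemma subgeodesic {X : MetricSpace} (a b : X) g t : geodesic_seg a b g ->
  0 <= t <= mdist a b -> geodesic_seg a (g t) g.
Proof.
  intros hg ht. destruct (geodesic_dist a b g t hg ht) as [E _].
  destruct hg as (H0 & H1 & H2). unfold geodesic_seg. rewrite E.
  repeat split; try assumption. intros; apply H2; lra.
Qed.

(** Translates the hinge inequality at half the length, divided by [sn e h], into an inequality
    between distances to the midpoint. *)
Lemma midpoint_cmp_identity e h u v z : 0 <= e ->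
  2 * cs e h * ip e h u z - ip e (2 * h) u v
  = md e u + md e v - 2 * md e h - 2 * cs e h * md e z.
Proof. intros he. unfold ip, cs. rewrite md_double by exact he. ring. Qed.

(** For [e = 0] this is the parallelogram law with an inequality in place of equality; [midpoint_le]
    is the opposite one, due to Bruhat and Tits. *)
Lemma midpoint_ge e (X : MetricSpace) (a b p : X) g : 0 <= e -> hinge e X Rge ->
  geodesic_seg a b g ->
  md e (mdist a p) + md e (mdist b p) - 2 * md e (mdist a b / 2)
  <= 2 * cs e (mdist a b / 2) * md e (mdist (g (mdist a b / 2)) p).
Proof.
  intros he H hg. pose proof (mdist_nonneg a b) as hab.
  destruct (Req_dec (mdist a b) 0) as [Z | Z].
  - rewrite Z. replace (0 / 2) with 0 by field. destruct hg as [-> _].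
    apply mdist_eq0 in Z as <-. unfold cs. rewrite md_0. lra.
  - specialize (H a b p g (mdist a b / 2) hg ltac:(lra)).
    unfold pr in H. destruct (geodesic_dist a b g (mdist a b / 2) hg ltac:(lra)) as [E _].
    rewrite E in H.
    set (h := mdist a b / 2) in *. replace (mdist a b) with (2 * h) in * by (unfold h; field).
    pose proof (midpoint_cmp_identity e h (mdist a p) (mdist b p) (mdist (g h) p) he) as I.
    rewrite sn_double in H by exact he.
    pose proof (sn_pos e h he ltac:(lra)) as P.
    assert (2 * cs e h * ip e h (mdist a p) (mdist (g h) p)
            <= ip e (2 * h) (mdist a p) (mdist b p)); [|lra].
    apply (Rmult_le_reg_l (sn e h)); [exact P | lra].
Qed.

Lemma midpoint_le e (X : MetricSpace) (a b p : X) g : 0 <= e -> hinge e X Rle ->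
  geodesic_seg a b g ->
  2 * cs e (mdist a b / 2) * md e (mdist (g (mdist a b / 2)) p)
  <= md e (mdist a p) + md e (mdist b p) - 2 * md e (mdist a b / 2).
Proof.
  intros he H hg. pose proof (mdist_nonneg a b) as hab.
  destruct (Req_dec (mdist a b) 0) as [Z | Z].
  - rewrite Z. replace (0 / 2) with 0 by field. destruct hg as [-> _].
    apply mdist_eq0 in Z as <-. unfold cs. rewrite md_0. lra.
  - specialize (H a b p g (mdist a b / 2) hg ltac:(lra)).
    unfold pr in H. destruct (geodesic_dist a b g (mdist a b / 2) hg ltac:(lra)) as [E _].
    rewrite E in H.
    set (h := mdist a b / 2) in *. replace (mdist a b) with (2 * h) in * by (unfold h; field).
    pose proof (midpoint_cmp_identity e h (mdist a p) (mdist b p) (mdist (g h) p) he) as I.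
    rewrite sn_double in H by exact he.
    pose proof (sn_pos e h he ltac:(lra)) as P.
    assert (ip e (2 * h) (mdist a p) (mdist b p)
            <= 2 * cs e h * ip e h (mdist a p) (mdist (g h) p)); [|lra].
    apply (Rmult_le_reg_l (sn e h)); [exact P | lra].
Qed.

(** * Adding tangent vectors in a space of curvature bounded below *)

Lemma pr_scaled e (X : MetricSpace) (x a p : X) g t t' r : 0 <= e -> hinge e X Rge ->
  geodesic_seg x a g -> 0 <= t <= t' -> 0 < t' <= mdist x a -> sn e t = r * sn e t' ->
  pr e x (g t) p <= r * pr e x (g t') p.
Proof.
  intros he H hg ht ht' E.
  pose proof (subgeodesic x a g t' hg ltac:(lra)) as hg'.
  destruct (geodesic_dist x a g t' hg ltac:(lra)) as [D _].
  (* On the geodesic from [x] to [g t'] the hinge says that the quotient of [pr e x (g t) p] by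
     [sn e t] is nondecreasing in [t]. *)
  specialize (H x (g t') p g t hg' ltac:(lra)). rewrite D, E in H.
  apply (Rmult_le_reg_l (sn e t')); [apply sn_pos; lra | lra].
Qed.

(** How far the midpoint [m] of [a] and [b] lies above the median of the model triangle
    with vertex [x]. The bound from above uses that the geodesic from [x] to [a] extends
    to [g (2 * t)]: it applies the midpoint inequality to [x], [g (2 * t)] seen from [m],
    and then to [a], [b] seen from [g (2 * t)]. *)
Lemma median_defect e (X : MetricSpace) (x a1 b : X) g g' t d : 0 <= e -> hinge e X Rge ->
  geodesic_seg x a1 g -> 0 <= 2 * t <= mdist x a1 ->
  geodesic_seg (g t) b g' -> d = mdist (g t) b / 2 ->
  2 * cs e d * md e (mdist x (g' d)) - md e t - md e (mdist x b) + 2 * md e d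
  <= pr e x (g (2 * t)) b - 2 * cs e t * pr e x (g t) b.
Proof.
  intros he H hg ht hg' Ed.
  destruct (geodesic_dist x a1 g t hg ltac:(lra)) as [D1 _].
  destruct (geodesic_dist x a1 g (2 * t) hg ltac:(lra)) as [D2 _].
  pose proof (mdist_nonneg (g t) b) as hab.
  destruct (geodesic_dist (g t) b g' d hg' ltac:(lra)) as [D3 _].
  assert (mdist (g t) (g (2 * t)) = t) as D4.
  { destruct hg as (_ & _ & hg). rewrite hg by lra.
    rewrite Rabs_minus_sym, Rabs_right; lra. }
  pose proof (midpoint_ge e X x (g (2 * t)) (g' d) g he H
    (subgeodesic x a1 g (2 * t) hg ltac:(lra))) as M1.
  pose proof (midpoint_ge e X (g t) b (g (2 * t)) g' he H hg') as M2.
  rewrite D2 in M1. replace (2 * t / 2) with t in M1 by field.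
  rewrite D3 in M1. rewrite <- Ed, D4 in M2.
  rewrite (mdist_sym X (g' d) (g (2 * t))), (mdist_sym X b (g (2 * t))) in M2.
  unfold pr, ip. rewrite D1, D2, md_double by exact he.
  replace (mdist (g t) b) with (2 * d) by (rewrite Ed; field).
  rewrite md_double by exact he.
  pose proof (cs_ge1 e d he) as Hc.
  apply (Rmult_le_compat_l (2 * cs e d)) in M1; [|lra].
  unfold cs in *. lra.
Qed.

(** The midpoint inequality seen from [p], rewritten as subadditivity of [pr] up to an error whose
    first factor is the quantity bounded in [median_defect]. *)
Lemma midpoint_pr e (X : MetricSpace) (x a b p : X) g d : 0 <= e -> hinge e X Rge ->
  geodesic_seg a b g -> d = mdist a b / 2 ->
  2 * cs e d * pr e x (g d) p <= pr e x a p + pr e x b p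
    + (2 * cs e d * md e (mdist x (g d)) - md e (mdist x a) - md e (mdist x b) + 2 * md e d)
      * cs e (mdist x p).
Proof.
  intros he H hg Ed. pose proof (midpoint_ge e X a b p g he H hg) as M.
  rewrite <- Ed in M. unfold pr, ip, cs in *. lra.
Qed.

Lemma exists_small_drop (u : nat -> R) B : (forall n, u (S n) <= u n) -> (forall n, B <= u n) ->
  forall eps, 0 < eps -> exists n, u n - u (S n) < eps.
Proof.
  intros Hd HB eps he.
  destruct (Classical_Prop.classic (exists n, u n - u (S n) < eps)) as [|N]; [assumption|].
  assert (forall n, u n <= u 0%nat - INR n * eps) as H.
  { induction n as [|n IH]; [simpl; lra|].
    destruct (Rlt_or_le (u n - u (S n)) eps) as [L|L]; [destruct N; now exists n|].
    rewrite S_INR. lra. }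
  destruct (INR_unbounded ((u 0%nat - B) / eps)) as [n Hn].
  specialize (H n). specialize (HB n).
  apply Rlt_div_l in Hn; lra.
Qed.

(** In the tangent cone at [x], the vector [w1 a1 + w2 a2] is twice the midpoint of [w1 a1]
    and [w2 a2]. Rescaled to a small size [s], this is approximated by the midpoint [m] of
    points [a1^s], [a2^s] on the geodesics from [x]; the error is the variation between [s]
    and [4 s] of a monotone bounded quantity, hence small for a suitable [s]. *)
Lemma merge_points e (X : MetricSpace) (x a1 a2 : X) w1 w2 eps :
  0 <= e -> geodesic_space X -> hinge e X Rge ->
  0 < w1 -> 0 < w2 -> 0 < mdist x a1 -> 0 < mdist x a2 -> 0 < eps ->
  exists W m, 0 <= W /\
    W * W * pr e x m m <= w1 * w1 * pr e x a1 a1 + w2 * w2 * pr e x a2 a2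
                          + 2 * (w1 * w2 * pr e x a1 a2) + eps /\
    forall p, W * pr e x m p <= w1 * pr e x a1 p + w2 * pr e x a2 p + eps * cs e (mdist x p).
Proof.
  intros he hX H hw1 hw2 hl1 hl2 heps.
  destruct (hX x a1) as [g1 hg1]. destruct (hX x a2) as [g2 hg2].
  set (l1 := mdist x a1) in *. set (l2 := mdist x a2) in *.
  pose proof (sn_pos e l1 he hl1) as hs1. pose proof (sn_pos e l2 he hl2) as hs2.
  set (A1 := w1 * sn e l1). set (A2 := w2 * sn e l2).
  assert (0 < A1) as hA1 by (unfold A1; nra). assert (0 < A2) as hA2 by (unfold A2; nra).
  (* [A1] and [A2] are the lengths of the weighted vectors; [t1 s] and [t2 s] are the parameters at
     which [sn] equals these lengths scaled by [s]. *)
  set (t1 := fun s => asn e (s * A1)). set (t2 := fun s => asn e (s * A2)).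
  (* The bounds with [w1] and [w2] keep the scaled points on the geodesics; the last one yields
     [cs e t <= 2] below. *)
  assert (exists s0, 0 < s0 <= 1 /\ 4 * (s0 * w1) <= 1 /\ 4 * (s0 * w2) <= 1
            /\ 4 * (s0 * (e * A1 ^ 2)) <= 1) as (s0 & hs0 & B1 & B2 & B3).
  { exists (/ (4 * (1 + w1 + w2 + e * A1 ^ 2))).
    assert (0 <= e * A1 ^ 2) by nra. set (z := 1 + w1 + w2 + e * A1 ^ 2).
    assert (1 <= z) by (unfold z; lra).
    assert (0 < / (4 * z)) as P by (apply Rinv_0_lt_compat; lra).
    assert (/ (4 * z) * (4 * z) = 1) as Q by (field; lra).
    set (i := / (4 * z)) in *. clearbody i.
    assert (4 * (i * w1) + 4 * (i * w2) + 4 * (i * (e * A1 ^ 2)) + 4 * i = 1)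
      by (rewrite <- Q; unfold z; ring).
    assert (0 < i * w1) by nra. assert (0 < i * w2) by nra.
    assert (0 <= i * (e * A1 ^ 2)) by nra. lra. }
  assert (forall s, sn e (t1 s) = s * A1) as S1 by (intros; apply sn_asn, he).
  assert (forall s, sn e (t2 s) = s * A2) as S2 by (intros; apply sn_asn, he).
  assert (forall s, 0 <= s -> 0 <= t1 s) as P1 by (intros; apply asn_nonneg; nra).
  assert (forall s, 0 <= s -> 0 <= t2 s) as P2 by (intros; apply asn_nonneg; nra).
  assert (forall s, 0 < s -> 0 < t1 s) as PP1.
  { intros s hs. destruct (P1 s ltac:(lra)) as [|Z]; [assumption|].
    pose proof (S1 s) as Q. rewrite <- Z, sn_0 in Q. nra. }
  assert (forall s, 0 < s -> 0 < t2 s) as PP2.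
  { intros s hs. destruct (P2 s ltac:(lra)) as [|Z]; [assumption|].
    pose proof (S2 s) as Q. rewrite <- Z, sn_0 in Q. nra. }
  assert (forall s s', 0 <= s <= s' -> t1 s <= t1 s') as M1.
  { intros s s' hs. apply (sn_le_inv e); [exact he | apply P1; lra|]. rewrite !S1. nra. }
  assert (forall s s', 0 <= s <= s' -> t2 s <= t2 s') as M2.
  { intros s s' hs. apply (sn_le_inv e); [exact he | apply P2; lra|]. rewrite !S2. nra. }
  assert (forall s, 0 <= s <= s0 -> t1 s <= l1) as L1.
  { intros s hs. apply (sn_le_inv e); [exact he | lra|]. rewrite S1. unfold A1.
    assert (s * w1 <= 1) by nra. nra. }
  assert (forall s, 0 <= s <= s0 -> t2 s <= l2) as L2.
  { intros s hs. apply (sn_le_inv e); [exact he | lra|]. rewrite S2. unfold A2.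
    assert (s * w2 <= 1) by nra. nra. }
  assert (forall s p, 0 < s <= s0 -> pr e x (g1 (t1 s)) p <= s * w1 * pr e x a1 p) as R1.
  { intros s p hs. destruct (hg1) as (_ & E & _). fold l1 in E. rewrite <- E.
    apply (pr_scaled e X x a1 p g1 (t1 s) l1); auto.
    - split; [apply P1 | apply L1]; lra.
    - fold l1; lra.
    - rewrite S1. unfold A1. ring. }
  assert (forall s p, 0 < s <= s0 -> pr e x (g2 (t2 s)) p <= s * w2 * pr e x a2 p) as R2.
  { intros s p hs. destruct (hg2) as (_ & E & _). fold l2 in E. rewrite <- E.
    apply (pr_scaled e X x a2 p g2 (t2 s) l2); auto.
    - split; [apply P2 | apply L2]; lra.
    - fold l2; lra.
    - rewrite S2. unfold A2. ring. }
  (* The rescaled inner product. It is nondecreasing, by rescaling the two points one after the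
     other, and the triangle inequality bounds it below by [- (A1 * A2)]. *)
  set (T := fun s => pr e x (g1 (t1 s)) (g2 (t2 s)) / s ^ 2).
  assert (forall s s' p, 0 < s <= s' -> s' <= s0 ->
    pr e x (g2 (t2 s)) p <= s / s' * pr e x (g2 (t2 s')) p) as R2'.
  { intros s s' p hs hs'. apply (pr_scaled e X x a2 p g2 (t2 s) (t2 s')); auto.
    - split; [apply P2 | apply M2]; lra.
    - split; [apply PP2 | apply L2]; lra.
    - rewrite !S2. field; lra. }
  assert (forall s s' p, 0 < s <= s' -> s' <= s0 ->
    pr e x (g1 (t1 s)) p <= s / s' * pr e x (g1 (t1 s')) p) as R1'.
  { intros s s' p hs hs'. apply (pr_scaled e X x a1 p g1 (t1 s) (t1 s')); auto.
    - split; [apply P1 | apply M1]; lra.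
    - split; [apply PP1 | apply L1]; lra.
    - rewrite !S1. field; lra. }
  assert (forall s, 0 < s -> pr e x (g1 (t1 s)) (g2 (t2 s)) = s ^ 2 * T s) as ET.
  { intros s hs. unfold T. field; lra. }
  assert (forall s s', 0 < s <= s' -> s' <= s0 -> T s <= T s') as MT.
  { intros s s' hs hs'.
    pose proof (R1' s s' (g2 (t2 s)) hs hs') as Q1.
    pose proof (R2' s s' (g1 (t1 s')) hs hs') as Q2.
    rewrite (pr_sym e x (g2 (t2 s))), (pr_sym e x (g2 (t2 s'))) in Q2.
    rewrite ET in Q1 by lra. rewrite ET in Q2 by lra.
    assert (0 < s / s') as Q3 by (apply Rdiv_lt_0_compat; lra).
    apply (Rmult_le_reg_l (s ^ 2)); [nra|].
    apply (Rle_trans _ _ _ Q1).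
    replace (s ^ 2 * T s') with (s / s' * (s / s' * (s' ^ 2 * T s'))) by (field; lra).
    nra. }
  assert (forall s, 0 < s <= s0 -> - (A1 * A2) <= T s) as BT.
  { intros s hs. pose proof (pr_ge e x (g1 (t1 s)) (g2 (t2 s)) he) as Q.
    destruct (geodesic_dist x a1 g1 (t1 s) hg1
      (conj (P1 s ltac:(lra)) (L1 s ltac:(lra)))) as [D1 _].
    destruct (geodesic_dist x a2 g2 (t2 s) hg2
      (conj (P2 s ltac:(lra)) (L2 s ltac:(lra)))) as [D2 _].
    rewrite D1, D2, S1, S2, ET in Q by lra.
    apply (Rmult_le_reg_l (s ^ 2)); nra. }
  set (La := cs e (2 * (l1 + l2))).
  (* [La] bounds [cs] at all distances that occur in the configuration; [K] then bounds the total
     coefficient [K1] of the error [F] in the estimate of the square. *)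
  set (K := 2 * La + 2 * La ^ 2).
  pose proof (cs_ge1 e (2 * (l1 + l2)) he) as hLa. fold La in hLa.
  assert (1 <= K) as hK by (unfold K; nra).
  set (sq := fun n : nat => s0 * (/ 4) ^ n).
  assert (forall n, 0 < sq n <= s0) as hsq.
  { intros n. unfold sq. assert (0 < (/ 4) ^ n <= 1); [|nra].
    split; [apply pow_lt; lra|]. rewrite <- (pow1 n). apply pow_incr; lra. }
  assert (forall n, sq n = 4 * sq (S n)) as hsq4 by (intros n; unfold sq; simpl; field).
  destruct (exists_small_drop (fun n => T (sq n)) (- (A1 * A2))) with (eps := eps / (4 * K))
    as [n Hn].
  { intros n. apply MT; [|apply hsq]. pose proof (hsq (S n)). pose proof (hsq4 n). lra. }
  { intros n. apply BT, hsq. }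
  { apply Rdiv_lt_0_compat; lra. }
  rewrite hsq4 in Hn. pose proof (hsq n) as h4s. rewrite hsq4 in h4s.
  pose proof (hsq (S n)) as hs. set (s := sq (S n)) in *. clearbody s. clear sq hsq hsq4.
  set (t := t1 s). set (a := g1 t). set (b := g2 (t2 s)).
  assert (sn e t = s * A1) as St by apply S1.
  assert (cs e t <= 2) as hct.
  { unfold cs. pose proof (md_le_sn_sqr e t he) as Q. rewrite St in Q.
    assert (e * (s * A1) ^ 2 <= 1); [|nra].
    replace (e * (s * A1) ^ 2) with (s * (s * (e * A1 ^ 2))) by ring.
    assert (0 <= e * A1 ^ 2) by nra. nra. }
  pose proof (cs_ge1 e t he) as hct1.
  (* The scale 4 is needed rather than 2 because [sn e (2 * t)] is [2 * cs e t * sn e t], with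
     [cs e t] only known to be at most 2. *)
  assert (2 * t <= t1 (4 * s)) as h2t.
  { apply (sn_le_inv e); [exact he | apply P1; lra|].
    rewrite sn_double, St, S1 by exact he.
    assert (cs e t * (s * A1) <= 2 * (s * A1)) by (apply Rmult_le_compat_r; nra). lra. }
  pose proof (PP1 s ltac:(lra)) as ht. fold t in ht.
  pose proof (L1 (4 * s) ltac:(lra)) as h4l.
  destruct (hX a b) as [g hg].
  remember (mdist a b / 2) as d eqn:Ed.
  pose proof (median_defect e X x a1 b g1 g t d he H hg1 ltac:(fold l1; lra) hg Ed) as F1.
  fold a in F1.
  destruct (geodesic_dist x a1 g1 t hg1 ltac:(fold l1; lra)) as [Da _]. fold a in Da.
  destruct (geodesic_dist x a2 g2 (t2 s) hg2
    (conj (P2 s ltac:(lra)) (L2 s ltac:(lra)))) as [Db _].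
  fold b in Db. rewrite Db in F1.
  set (F := 2 * cs e d * md e (mdist x (g d)) - md e t - md e (t2 s) + 2 * md e d) in *.
  assert (F <= 4 * s ^ 2 * (eps / (4 * K))) as HF.
  (* Rescaling first [g1 (2 * t)] and then [b] up to scale [4 * s] bounds the defect by
     [2 * cs e t * s ^ 2 * (T (4 * s) - T s)]. *)
  { apply (Rle_trans _ _ _ F1).
    pose proof (pr_scaled e X x a1 b g1 (2 * t) (t1 (4 * s)) (cs e t / 2) he H hg1
      ltac:(lra) ltac:(fold l1; lra)) as Q1.
    pose proof (R2' s (4 * s) (g1 (t1 (4 * s))) ltac:(lra) ltac:(lra)) as Q2.
    rewrite (pr_sym e x (g2 (t2 s))), (pr_sym e x (g2 (t2 (4 * s)))), ET in Q2 by lra.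
    fold b in Q2. replace (s / (4 * s)) with (/ 4) in Q2 by (field; lra).
    rewrite sn_double, St, S1 in Q1 by exact he.
    specialize (Q1 ltac:(field)).
    pose proof (ET s ltac:(lra)) as Q3. fold t a b in Q3. rewrite Q3.
    assert (cs e t / 2 * pr e x (g1 (t1 (4 * s))) b
            <= cs e t / 2 * (/ 4 * ((4 * s) ^ 2 * T (4 * s)))) as Q4 by (apply Rmult_le_compat_l; lra).
    assert (2 * cs e t * (s ^ 2 * (T (4 * s) - T s)) <= 4 * (s ^ 2 * (eps / (4 * K)))).
    { apply Rmult_le_compat; try lra.
      - pose proof (MT s (4 * s) ltac:(lra) ltac:(lra)). nra.
      - apply Rmult_le_compat_l; [nra | lra]. }
    lra. }
  assert (forall p, 2 * cs e d * pr e x (g d) p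
            <= pr e x a p + pr e x b p + F * cs e (mdist x p)) as HM.
  { intros p. pose proof (midpoint_pr e X x a b p g d he H hg Ed) as Q.
    rewrite Da, Db in Q. exact Q. }
  pose proof (cs_ge1 e d he) as hcd.
  (* The weight undoes both the halving at the midpoint and the scaling by [s]. *)
  exists (2 * cs e d / s), (g d).
  split; [apply Rlt_le, Rdiv_lt_0_compat; lra|].
  assert (4 * (eps / (4 * K)) = eps / K) as EK by (field; lra).
  assert (0 < eps / K) as hEK by (apply Rdiv_lt_0_compat; lra).
  assert (eps / K * K = eps) as EK2 by (field; lra).
  assert (F <= s ^ 2 * (eps / K)) as HF' by (rewrite <- EK; lra).
  split.
  - apply (Rmult_le_reg_l (s ^ 2)); [nra|].
    replace (s ^ 2 * (2 * cs e d / s * (2 * cs e d / s) * pr e x (g d) (g d)))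
      with (2 * cs e d * (2 * cs e d * pr e x (g d) (g d))) by (field; lra).
    (* The square is expanded as for a bilinear form: [HM] is applied at the midpoint itself, then
       at [a] and at [b]. *)
    pose proof (HM (g d)) as Q. pose proof (HM a) as Qa. pose proof (HM b) as Qb.
    apply (Rmult_le_compat_l (2 * cs e d)) in Q; [|lra].
    apply (Rle_trans _ _ _ Q).
    rewrite (pr_sym e x a (g d)), (pr_sym e x b (g d)).
    rewrite Da in Qa. rewrite Db in Qb.
    assert (pr e x a a = s ^ 2 * (w1 * w1 * pr e x a1 a1)) as Iaa.
    { rewrite !pr_self by exact he. rewrite Da. fold l1. rewrite St. unfold A1. ring. }
    assert (pr e x b b = s ^ 2 * (w2 * w2 * pr e x a2 a2)) as Ibb.
    { rewrite !pr_self by exact he. rewrite Db. fold l2. rewrite S2. unfold A2. ring. }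
    assert (pr e x a b <= s ^ 2 * (w1 * w2 * pr e x a1 a2)) as Iab.
    { pose proof (R1 s b ltac:(lra)) as Q1. fold t a in Q1.
      pose proof (R2 s a1 ltac:(lra)) as Q2. fold b in Q2.
      rewrite (pr_sym e x b a1), (pr_sym e x a2 a1) in Q2.
      apply (Rmult_le_compat_l (s * w1)) in Q2; [lra | nra]. }
    rewrite (pr_sym e x b a) in Qa.
    assert (forall z, 0 <= z <= 2 * (l1 + l2) -> cs e z <= La) as HLa.
    { intros z hz. unfold La, cs. pose proof (md_le e _ _ he hz). nra. }
    pose proof (mdist_nonneg a b). pose proof (L1 s ltac:(lra)) as Lt. fold t in Lt.
    pose proof (L2 s ltac:(lra)) as Lt2. pose proof (PP2 s ltac:(lra)).
    destruct (mdist_tri_abs x a b) as [_ Tr]. rewrite Da, Db in Tr.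
    destruct (geodesic_dist a b g d hg ltac:(lra)) as [Dm _].
    pose proof (mdist_tri X x a (g d)) as Trm. rewrite Da, Dm in Trm.
    pose proof (mdist_nonneg x (g d)).
    pose proof (HLa t ltac:(lra)) as h1. pose proof (HLa (t2 s) ltac:(lra)) as h2.
    pose proof (HLa d ltac:(lra)) as h3. pose proof (HLa (mdist x (g d)) ltac:(lra)) as h4.
    pose proof (cs_ge1 e (mdist x (g d)) he) as c4. pose proof (cs_ge1 e (t2 s) he).
    set (K1 := cs e t + cs e (t2 s) + 2 * (cs e d * cs e (mdist x (g d)))).
    assert (0 <= K1 <= K) as hK1.
    { unfold K1, K. assert (1 * 1 <= cs e d * cs e (mdist x (g d)) <= La * La).
      { split; apply Rmult_le_compat; lra. } lra. }
    assert (F * K1 <= s ^ 2 * eps) as HFK.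
    { apply (Rle_trans _ (s ^ 2 * (eps / K) * K1)).
      - apply Rmult_le_compat_r; lra.
      - rewrite Rmult_assoc. apply Rmult_le_compat_l; [nra|].
        rewrite <- EK2 at 2. apply Rmult_le_compat_l; lra. }
    unfold K1 in HFK. lra.
  - intros p. apply (Rmult_le_reg_l s); [lra|].
    replace (s * (2 * cs e d / s * pr e x (g d) p)) with (2 * cs e d * pr e x (g d) p)
      by (field; lra).
    apply (Rle_trans _ _ _ (HM p)).
    pose proof (R1 s p ltac:(lra)) as Q1. pose proof (R2 s p ltac:(lra)) as Q2. fold t a in Q1.
    fold b in Q2. pose proof (cs_ge1 e (mdist x p) he) as hp.
    assert (F <= s * eps) as HFs.
    { apply (Rle_trans _ _ _ HF'). replace (s ^ 2 * (eps / K)) with (s * (s * (eps / K))) by ring.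
      apply Rmult_le_compat_l; [lra|]. set (y := eps / K) in *. clearbody y. nra. }
    apply (Rmult_le_compat_r (cs e (mdist x p))) in HFs; [|lra]. lra.
Qed.

(** * Finite sums and nonnegativity of squares *)

Fixpoint lsum {T : Type} (f : T -> R) (L : list T) : R :=
  match L with nil => 0 | i :: L' => f i + lsum f L' end.

Definition dsum {T : Type} (f : T -> T -> R) (L : list T) : R :=
  lsum (fun i => lsum (f i) L) L.

Lemma lsum_le {T : Type} (f g : T -> R) L : (forall i, In i L -> f i <= g i) ->
  lsum f L <= lsum g L.
Proof.
  induction L as [|i L IH]; intros H; simpl; [lra|].
  pose proof (H i (or_introl eq_refl)). enough (lsum f L <= lsum g L) by lra.
  apply IH. intros; apply H; now right.
Qed.

Lemma lsum_ext {T : Type} (f g : T -> R) L : (forall i, In i L -> f i = g i) ->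
  lsum f L = lsum g L.
Proof.
  intros H. apply Rle_antisym; apply lsum_le; intros i hi; rewrite (H i hi); lra.
Qed.

Lemma lsum_lin {T : Type} (f g : T -> R) a b L :
  lsum (fun i => a * f i + b * g i) L = a * lsum f L + b * lsum g L.
Proof. induction L as [|i L IH]; simpl; [ring | rewrite IH; ring]. Qed.

Lemma lsum_eq0 {T : Type} (f : T -> R) L : (forall i, f i = 0) -> lsum f L = 0.
Proof. intros H. induction L as [|i L IH]; simpl; [|rewrite H, IH]; ring. Qed.

Lemma lsum_nonneg {T : Type} (f : T -> R) L : (forall i, In i L -> 0 <= f i) -> 0 <= lsum f L.
Proof.
  induction L as [|i L IH]; intros H; simpl; [lra|].
  pose proof (H i (or_introl eq_refl)). enough (0 <= lsum f L) by lra.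
  apply IH. intros; apply H; now right.
Qed.

Lemma lsum_term_le {T : Type} (f : T -> R) L i : (forall i, In i L -> 0 <= f i) -> In i L ->
  f i <= lsum f L.
Proof.
  induction L as [|j L IH]; intros H; simpl; [easy|]. intros [-> | hi].
  - pose proof (lsum_nonneg f L (fun k hk => H k (or_intror hk))). lra.
  - pose proof (H j (or_introl eq_refl)).
    pose proof (IH (fun k hk => H k (or_intror hk)) hi). lra.
Qed.

Lemma lsum_map {T U : Type} (h : U -> T) (f : T -> R) L :
  lsum f (map h L) = lsum (fun i => f (h i)) L.
Proof. induction L as [|i L IH]; simpl; [|rewrite IH]; reflexivity. Qed.

Lemma dsum_cons {T : Type} (f : T -> T -> R) i L : (forall i j, f i j = f j i) ->
  dsum f (i :: L) = f i i + 2 * lsum (f i) L + dsum f L.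
Proof.
  intros Hs. unfold dsum; simpl.
  rewrite (lsum_ext (fun j => f j i + lsum (f j) L)
                    (fun j => 1 * f i j + 1 * lsum (f j) L)).
  - rewrite (lsum_lin (f i) (fun j => lsum (f j) L)). ring.
  - intros j _. rewrite (Hs j i). ring.
Qed.

(** Lang and Schroeder's inequality. *)
Lemma CBB_sum_nonneg e (X : MetricSpace) (x : X) (L : list (R * X)) :
  0 <= e -> geodesic_space X -> hinge e X Rge -> (forall i, In i L -> 0 <= fst i) ->
  0 <= dsum (fun i j => fst i * fst j * pr e x (snd i) (snd j)) L.
Proof.
  intros he hX H.
  set (f := fun i j : R * X => fst i * fst j * pr e x (snd i) (snd j)).
  assert (forall i j, f i j = f j i) as fs by (intros; unfold f; rewrite pr_sym; ring).
  assert (forall i, 0 <= f i i) as fd.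
  { intros i. unfold f. rewrite pr_self by exact he. nra. }
  assert (forall n L, (length L <= n)%nat -> (forall i, In i L -> 0 <= fst i) ->
    0 <= dsum f L) as G; [|intros hL; now apply (G (length L))].
  clear L. induction n as [|n IH]; intros L hn hL.
  { destruct L; [unfold dsum; simpl; lra | simpl in hn; lia]. }
  destruct L as [|i L]; [unfold dsum; simpl; lra|]. simpl in hn.
  pose proof (hL i (or_introl eq_refl)) as hi.
  rewrite dsum_cons by exact fs.
  destruct (Req_dec (fst i * mdist x (snd i)) 0) as [Z | Zi].
  { assert (forall j, f i j = 0) as Zf.
    { intros j. unfold f. apply Rmult_integral in Z as [-> | Z]; [ring|].
      rewrite pr_base by exact Z. ring. }
    rewrite (lsum_eq0 _ _ Zf), Zf.
    assert (0 <= dsum f L) by (apply IH; [lia | intros; apply hL; now right]). lra. }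
  destruct L as [|j L].
  { unfold dsum; simpl. pose proof (fd i). lra. }
  pose proof (hL j (or_intror (or_introl eq_refl))) as hj.
  rewrite dsum_cons by exact fs.
  destruct (Req_dec (fst j * mdist x (snd j)) 0) as [Z | Zj].
  { assert (forall j', f j j' = 0) as Zf.
    { intros j'. unfold f. apply Rmult_integral in Z as [-> | Z]; [ring|].
      rewrite pr_base by exact Z. ring. }
    simpl. rewrite (lsum_eq0 _ _ Zf), (fs i j), !Zf.
    assert (0 <= dsum f (i :: L)) as Q.
    { apply IH; [simpl in *; lia|]. intros k [<- | hk]; [exact hi | apply hL; simpl; tauto]. }
    rewrite dsum_cons in Q by exact fs. lra. }
  simpl.
  set (c := lsum (fun k => fst k * cs e (mdist x (snd k))) L).
  assert (0 <= c) as hc.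
  { apply lsum_nonneg. intros k hk. pose proof (hL k ltac:(simpl; tauto)).
    pose proof (cs_ge1 e (mdist x (snd k)) he). nra. }
  (* Were the sum [v] negative, merging the first two points would raise it by at most
     [eps * (1 + 2 * c) = - v / 2], leaving a negative sum for a shorter list. *)
  apply Rnot_lt_le. intros N.
  match type of N with ?V < 0 => set (v := V) in N end.
  pose proof (mdist_nonneg x (snd i)). pose proof (mdist_nonneg x (snd j)).
  destruct (merge_points e X x (snd i) (snd j) (fst i) (fst j) (- v / (2 * (1 + 2 * c))))
    as (W & m & hW & Hm & Hp); try assumption; try nra.
  { apply Rdiv_lt_0_compat; lra. }
  set (eps := - v / (2 * (1 + 2 * c))) in *.
  assert (eps * (1 + 2 * c) = - v / 2) as Heps by (unfold eps; field; lra).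
  clearbody eps.
  assert (0 <= dsum f ((W, m) :: L)) as Q.
  { apply IH; [simpl in *; lia|]. intros k [<- | hk]; [exact hW | apply hL; simpl; tauto]. }
  rewrite dsum_cons in Q by exact fs.
  assert (lsum (f (W, m)) L <= 1 * lsum (f i) L + 1 * (1 * lsum (f j) L + eps * c)) as Q2.
  { unfold c. rewrite <- !lsum_lin. apply lsum_le. intros k hk.
    pose proof (hL k ltac:(simpl; tauto)) as hk0.
    pose proof (Rmult_le_compat_l _ _ _ hk0 (Hp (snd k))). unfold f; simpl. lra. }
  unfold f at 1 in Q; simpl in Q.
  assert (v = f i i + 2 * (f i j + lsum (f i) L) + (f j j + 2 * lsum (f j) L + dsum f L)) as Ev
    by reflexivity.
  unfold f at 1 2 4 in Ev. lra.
Qed.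

(** * Weak compactness of convex sets *)

Definition closed_set {Y : MetricSpace} (C : Y -> Prop) : Prop :=
  forall p, (forall eps, 0 < eps -> exists q, C q /\ mdist q p < eps) -> C p.

Definition midpoint_convex {Y : MetricSpace} (C : Y -> Prop) : Prop :=
  forall a b g, C a -> C b -> geodesic_seg a b g -> C (g (mdist a b / 2)).

(** Uniform convexity of [md] of the distance, obtained by estimating the factor [cs] from below by
    1. *)
Lemma midpoint_md e (Y : MetricSpace) (a b p : Y) g : 0 <= e -> hinge e Y Rle ->
  geodesic_seg a b g ->
  md e (mdist (g (mdist a b / 2)) p)
  <= (md e (mdist a p) + md e (mdist b p)) / 2 - md e (mdist a b / 2).
Proof.
  intros he H hg. pose proof (midpoint_le e Y a b p g he H hg) as M.
  pose proof (cs_ge1 e (mdist a b / 2) he).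
  pose proof (md_nonneg e (mdist (g (mdist a b / 2)) p) he). nra.
Qed.

(** Weak compactness of bounded closed convex sets: the almost nearest points to [o] in
    larger and larger finite intersections form a Cauchy sequence. *)
Lemma finite_intersection e (Y : MetricSpace) {I : Type} (C : I -> Y -> Prop) i0 o B :
  0 <= e -> geodesic_space Y -> hinge e Y Rle -> complete Y ->
  (forall i, closed_set (C i)) -> (forall i, midpoint_convex (C i)) ->
  (forall L : list I, exists z, forall i, In i L -> C i z) ->
  (forall z, C i0 z -> mdist o z <= B) ->
  exists z, forall i, C i z.
Proof.
  intros he hY H hc hcl hco hfin hB.
  set (F := fun z => md e (mdist z o)).
  (* Lower bounds for [F] on finite intersections inside [C i0]; the supremum [V] is the limiting
     value of the infima. *)
  set (S := fun r => exists L, forall z, C i0 z -> (forall i, In i L -> C i z) -> r <= F z).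
  destruct (completeness S) as [V [HV1 HV2]].
  { exists (md e B). intros r [L hL].
    destruct (hfin (i0 :: L)) as [z hz].
    assert (C i0 z) as h0 by (apply hz; now left).
    apply (Rle_trans _ (F z)); [apply hL; [exact h0 | intros; apply hz; now right]|].
    apply md_le; [exact he|]. split; [apply mdist_nonneg|].
    rewrite mdist_sym. now apply hB. }
  { exists 0, nil. intros z _ _. now apply md_nonneg. }
  assert (forall n : nat, exists L, forall z, C i0 z -> (forall i, In i L -> C i z) ->
            V - / (INR n + 1) <= F z) as HL.
  { intros n. apply Classical_Prop.NNPP. intros N.
    assert (0 < / (INR n + 1)) as P by (apply Rinv_0_lt_compat; pose proof (pos_INR n); lra).
    assert (V <= V - / (INR n + 1)); [|lra].
    apply HV2. intros r [L hL]. apply Rnot_lt_le. intros hr. apply N. exists L.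
    intros z h1 h2. specialize (hL z h1 h2). lra. }
  destruct (functional_choice _ HL) as [Lf HLf].
  assert (forall L (n : nat), exists z, C i0 z /\ (forall i, In i L -> C i z) /\
            F z <= V + / (INR n + 1)) as Hz.
  { intros L n. apply Classical_Prop.NNPP. intros N.
    assert (0 < / (INR n + 1)) as P by (apply Rinv_0_lt_compat; pose proof (pos_INR n); lra).
    assert (V + / (INR n + 1) <= V); [|lra].
    apply HV1. exists L. intros z h1 h2. apply Rlt_le, Rnot_le_lt. intros hz.
    apply N. now exists z. }
  (* The midpoint lies in the same sets, so [F] is at least [V - / (INR n + 1)] there. Uniform
     convexity then gives one eighth of the squared distance as at most [2 * / (INR n + 1)]. *)
  assert (forall n z z', C i0 z -> C i0 z' -> (forall i, In i (Lf n) -> C i z) ->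
    (forall i, In i (Lf n) -> C i z') -> F z <= V + / (INR n + 1) ->
    F z' <= V + / (INR n + 1) -> mdist z z' ^ 2 <= 16 * / (INR n + 1)) as Hclose.
  { intros n z z' h0 h0' hz hz' hF hF'. destruct (hY z z') as [g hg].
    pose proof (midpoint_md e Y z z' o g he H hg) as M.
    assert (V - / (INR n + 1) <= F (g (mdist z z' / 2))) as M'.
    { apply HLf; [|intros i hi]; apply hco; auto. }
    pose proof (md_ge_sqr e (mdist z z' / 2) he) as Q.
    pose proof (mdist_nonneg z z'). specialize (Q ltac:(lra)).
    unfold F in *. nra. }
  (* Collecting all families up to [n] makes the constraints increase with [n], so that late terms
     can be compared. *)
  set (K := fun n : nat => concat (map Lf (seq 0 (Datatypes.S n)))).
  assert (forall k n i, (k <= n)%nat -> In i (Lf k) -> In i (K n)) as HK.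
  { intros k n i hk hi. unfold K. apply in_concat. exists (Lf k). split; [|exact hi].
    apply in_map, in_seq. lia. }
  assert (forall k n : nat, (k <= n)%nat -> / (INR n + 1) <= / (INR k + 1)) as Hinv.
  { intros k n hk. apply le_INR in hk. pose proof (pos_INR k).
    apply Rinv_le_contravar; lra. }
  destruct (functional_choice _ (fun n => Hz (K n) n)) as [p Hp].
  assert (forall eps, 0 < eps -> exists N : nat, 16 * / (INR N + 1) < eps ^ 2) as Harch.
  { intros eps heps. assert (0 < eps ^ 2) as P by nra.
    destruct (INR_unbounded (16 / eps ^ 2)) as [N HN]. exists N.
    pose proof (pos_INR N). apply Rlt_div_l in HN; [|exact P].
    apply (Rmult_lt_reg_r (INR N + 1)); [lra|].
    rewrite Rmult_assoc, Rinv_l by lra. lra. }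
  destruct (hc p) as [l Hl].
  { intros eps heps. destruct (Harch eps heps) as [N HN]. exists N. intros m n hm hn.
    destruct (Hp m) as (a1 & a2 & a3). destruct (Hp n) as (b1 & b2 & b3).
    assert (mdist (p m) (p n) ^ 2 <= 16 * / (INR N + 1)) as Q.
    { apply Hclose; auto.
      - intros i hi. apply a2. now apply (HK N).
      - intros i hi. apply b2. now apply (HK N).
      - pose proof (Hinv N m hm). lra.
      - pose proof (Hinv N n hn). lra. }
    pose proof (mdist_nonneg (p m) (p n)). nra. }
  exists l. intros j. apply hcl. intros eps heps.
  destruct (Harch (eps / 2) ltac:(lra)) as [N1 HN1].
  destruct (Hl (eps / 2) ltac:(lra)) as [N2 HN2].
  set (n := Nat.max N1 N2).
  specialize (HN2 n ltac:(lia)).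
  (* Adding the constraint [j] yields an almost minimal point of [C j], which must be close to [p n]
     and hence to [l]. *)
  destruct (Hz (j :: K n) n) as (q & q1 & q2 & q3).
  exists q. split; [apply q2; now left|].
  destruct (Hp n) as (a1 & a2 & a3).
  assert (mdist q (p n) ^ 2 <= 16 * / (INR n + 1)) as Q.
  { apply Hclose; auto.
    - intros i hi. apply q2. right. now apply (HK n).
    - intros i hi. apply a2. now apply (HK n). }
  pose proof (Hinv N1 n ltac:(lia)).
  pose proof (mdist_tri Y q (p n) l). pose proof (mdist_nonneg q (p n)).
  assert (mdist q (p n) < eps / 2) by nra. lra.
Qed.

(** * The penalty and the intersection property of balls *)

Definition excess e {Y : MetricSpace} (y : Y) (rho : R) (z : Y) : R :=
  Rmax 0 (md e (mdist z y) - rho).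

(** Squaring smooths the truncation: the derivative of a term with respect to [md] of the distance
    is twice its [excess], which supplies the weights. *)
Definition penalty e {Y : MetricSpace} {I : Type} (y : I -> Y) (rho : I -> R) L (z : Y) : R :=
  lsum (fun i => excess e (y i) (rho i) z ^ 2) L.

Lemma Rmax0_eq r : Rmax 0 r = (r + Rabs r) / 2.
Proof. unfold Rmax, Rabs. destruct (Rle_dec 0 r), (Rcase_abs r); lra. Qed.

(** A quadratic upper bound that takes the place of differentiability. *)
Lemma Rmax0_sqr_add a b : Rmax 0 (a + b) ^ 2 <= Rmax 0 a ^ 2 + 2 * Rmax 0 a * b + b ^ 2.
Proof. unfold Rmax. destruct (Rle_dec 0 (a + b)), (Rle_dec 0 a); nra. Qed.

Lemma Rmax0_le a b : a <= b -> Rmax 0 a <= Rmax 0 b.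
Proof. intros. now apply Rle_max_compat_l. Qed.

Lemma Rmax0_sqr_mid a b c : c <= (a + b) / 2 ->
  Rmax 0 c ^ 2 <= (Rmax 0 a ^ 2 + Rmax 0 b ^ 2) / 2.
Proof.
  intros h. pose proof (Rmax_l 0 a). pose proof (Rmax_l 0 b). pose proof (Rmax_l 0 c).
  assert (Rmax 0 c <= (Rmax 0 a + Rmax 0 b) / 2) as H2.
  { apply Rmax_lub; [lra|]. pose proof (Rmax_r 0 a). pose proof (Rmax_r 0 b). lra. }
  pose proof (pow_incr _ _ 2 (conj H1 H2)). pose proof (pow2_ge_0 (Rmax 0 a - Rmax 0 b)). lra.
Qed.

Lemma penalty_lsc e (Y : MetricSpace) {I : Type} (y : I -> Y) rho L p eps : 0 < eps ->
  exists del, 0 < del /\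
    forall z, mdist z p < del -> penalty e y rho L p <= penalty e y rho L z + eps.
Proof.
  revert eps. unfold penalty. induction L as [|i L IH]; intros eps heps; simpl.
  { exists 1. split; [lra|]. intros; lra. }
  destruct (IH (eps / 2) ltac:(lra)) as (d1 & hd1 & Hd1).
  assert (continuity (fun t => Rmax 0 (md e t - rho i) ^ 2)) as Hcont.
  { intros t. apply (continuity_pt_ext (fun t => ((md e t - rho i + Rabs (md e t - rho i)) / 2) ^ 2)).
    { intros s. rewrite Rmax0_eq. reflexivity. }
    pose proof (md_continuity e t) as Hm.
    pose proof (continuity_pt_minus _ (fun _ => rho i) t Hm
      (continuity_pt_const (fun _ => rho i) t (fun _ _ => eq_refl))) as H1.
    apply (continuity_pt_comp (fun t => md e t - rho i) (fun r => ((r + Rabs r) / 2) ^ 2));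
      [exact H1|].
    assert (continuity_pt (fun r => (r + Rabs r) * / 2) (md e t - rho i)) as H2.
    { apply continuity_pt_mult; [|apply continuity_pt_const; easy].
      apply continuity_pt_plus; [apply continuity_pt_id | apply Rcontinuity_abs]. }
    apply (continuity_pt_comp (fun r => (r + Rabs r) * / 2) (fun r => r ^ 2)); [exact H2|].
    reg. }
  destruct (Hcont (mdist p (y i)) (eps / 2) ltac:(lra)) as (d2 & hd2 & Hd2).
  exists (Rmin d1 d2). split; [apply Rmin_pos; lra|].
  intros z hz. pose proof (Rmin_l d1 d2). pose proof (Rmin_r d1 d2).
  specialize (Hd1 z ltac:(lra)).
  enough (excess e (y i) (rho i) p ^ 2 <= excess e (y i) (rho i) z ^ 2 + eps / 2) by (simpl in *; lra).
  unfold excess.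
  destruct (Req_dec (mdist p (y i)) (mdist z (y i))) as [-> | Ne]; [lra|].
  specialize (Hd2 (mdist z (y i))). simpl in Hd2. unfold Rdist in Hd2.
  pose proof (mdist_tri Y z p (y i)). pose proof (mdist_tri Y p z (y i)).
  rewrite (mdist_sym Y p z) in *.
  assert (Rabs (mdist z (y i) - mdist p (y i)) < d2) as A by (apply Rabs_def1; lra).
  specialize (Hd2 (conj (conj Logic.I Ne) A)).
  apply Rabs_def2 in Hd2. simpl. lra.
Qed.

Lemma penalty_midpoint e (Y : MetricSpace) {I : Type} (y : I -> Y) rho L a b g :
  0 <= e -> hinge e Y Rle -> geodesic_seg a b g ->
  penalty e y rho L (g (mdist a b / 2)) <= (penalty e y rho L a + penalty e y rho L b) / 2.
Proof.
  intros he H hg. unfold penalty.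
  replace ((lsum _ L + lsum _ L) / 2) with
    (/ 2 * lsum (fun i => excess e (y i) (rho i) a ^ 2) L
     + / 2 * lsum (fun i => excess e (y i) (rho i) b ^ 2) L) by field.
  rewrite <- lsum_lin. apply lsum_le. intros i _.
  pose proof (midpoint_md e Y a b (y i) g he H hg).
  pose proof (md_nonneg e (mdist a b / 2) he).
  unfold excess.
  pose proof (Rmax0_sqr_mid (md e (mdist a (y i)) - rho i) (md e (mdist b (y i)) - rho i)
    (md e (mdist (g (mdist a b / 2)) (y i)) - rho i) ltac:(lra)). lra.
Qed.

(** The sublevel sets above the infimum [m] are nested, closed and midpoint convex, and bounded
    thanks to the term of index [i]; a point common to all of them is a minimizer. *)
Lemma penalty_minimizer e (Y : MetricSpace) {I : Type} (y : I -> Y) rho i L :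
  0 <= e -> geodesic_space Y -> hinge e Y Rle -> complete Y -> In i L ->
  exists z, forall z', penalty e y rho L z <= penalty e y rho L z'.
Proof.
  intros he hY H hc hi. set (P := penalty e y rho L).
  assert (forall z, 0 <= P z) as hP by (intros; apply lsum_nonneg; intros; apply pow2_ge_0).
  destruct (completeness (fun r => forall z, r <= P z)) as [m [Hm1 Hm2]].
  { exists (P (y i)). intros r hr. apply hr. }
  { now exists 0. }
  assert (forall z, m <= P z) as Hm by (intros z; apply Hm2; intros r hr; apply hr).
  assert (0 <= m) as hm by (now apply Hm1).
  assert (forall del, 0 < del -> exists z, P z <= m + del) as Hex.
  { intros del hdel. apply Classical_Prop.NNPP. intros N.
    assert (m + del <= m); [|lra]. apply Hm1. intros z. apply Rlt_le, Rnot_le_lt.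
    intros hz. apply N. now exists z. }
  destruct (finite_intersection e Y (fun (d : {d : R | 0 < d}) z => P z <= m + proj1_sig d)
    (exist _ 1 Rlt_0_1) (y i) (rho i + m + 3)) as [z Hz]; auto.
  - intros [d hd] p Hp. simpl in *. apply le_epsilon. intros eps heps.
    destruct (penalty_lsc e Y y rho L p eps heps) as (del & hdel & Hdel).
    destruct (Hp del hdel) as (q & q1 & q2). specialize (Hdel q q2).
    unfold P in *. lra.
  - intros d a b g ha hb hg. simpl in *.
    pose proof (penalty_midpoint e Y y rho L a b g he H hg). fold P in H0. lra.
  - intros K.
    assert (exists d0, 0 < d0 /\ forall d, In d K -> d0 <= proj1_sig d) as (d0 & hd0 & Hd0).
    { induction K as [|[d hd] K (d0 & hd0 & Hd0)].
      - exists 1. split; [lra | easy].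
      - exists (Rmin d d0). split; [now apply Rmin_pos|].
        intros d' [<- | hd']; simpl; [apply Rmin_l|].
        eapply Rle_trans; [apply Rmin_r | now apply Hd0]. }
    destruct (Hex d0 hd0) as [z hz]. exists z. intros d hd. specialize (Hd0 d hd). lra.
  - simpl. intros z hz.
    pose proof (lsum_term_le (fun i => excess e (y i) (rho i) z ^ 2) L i
      (fun _ _ => pow2_ge_0 _) hi) as Q. simpl in Q.
    change (lsum _ L) with (P z) in Q.
    pose proof (Rmax_r 0 (md e (mdist z (y i)) - rho i)) as Q1.
    pose proof (Rmax_l 0 (md e (mdist z (y i)) - rho i)) as Q2.
    fold (excess e (y i) (rho i) z) in Q1, Q2.
    pose proof (md_ge_sqr e (mdist z (y i)) he (mdist_nonneg _ _)).
    rewrite mdist_sym.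
    (* Here the squared excess is at most [m + 1], and a distance [r] is at most
       [(r ^ 2 + 1) / 2]. *)
    assert (excess e (y i) (rho i) z <= m + 2) by nra.
    pose proof (pow2_ge_0 (mdist z (y i) - 1)). lra.
  - exists z. intros z'. apply (Rle_trans _ m); [|apply Hm].
    apply le_epsilon. intros eps heps. apply (Hz (exist _ eps heps)).
Qed.

Lemma linear_le_quadratic a M u0 : 0 < u0 -> (forall u, 0 < u <= u0 -> u * a <= u ^ 2 * M) ->
  a <= 0.
Proof.
  intros hu0 H. apply Rnot_lt_le. intros ha.
  assert (0 < a / (2 * (Rabs M + 1))) as Q.
  { apply Rdiv_lt_0_compat; pose proof (Rabs_pos M); lra. }
  pose proof (Rabs_pos M). pose proof (Rle_abs M).
  set (u := Rmin u0 (a / (2 * (Rabs M + 1)))).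
  assert (0 < u) by (now apply Rmin_pos).
  assert (u <= u0) by apply Rmin_l.
  assert (u <= a / (2 * (Rabs M + 1))) as Hu by apply Rmin_r.
  apply Rle_div_r in Hu; [|lra].
  specialize (H u ltac:(lra)). nra.
Qed.

(** Moving from [z] towards [p] changes the penalty by at most a linear term plus a quadratic one,
    by the hinge inequality; minimality then fixes the sign of the linear coefficient. *)
Lemma penalty_first_order e (Y : MetricSpace) {I : Type} (y : I -> Y) rho L z p :
  0 <= e -> geodesic_space Y -> hinge e Y Rle ->
  (forall z', penalty e y rho L z <= penalty e y rho L z') ->
  lsum (fun i => excess e (y i) (rho i) z * pr e z p (y i)) L <= 0.
Proof.
  intros he hY H Hmin.
  pose proof (mdist_nonneg z p) as hl.
  destruct (Req_dec (mdist z p) 0) as [Z | Z].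
  { rewrite lsum_eq0; [lra|]. intros i. rewrite pr_base by exact Z. ring. }
  destruct (hY z p) as [g hg]. set (l := mdist z p) in *.
  pose proof (sn_pos e l he ltac:(lra)) as hs.
  set (mu := fun i => excess e (y i) (rho i) z).
  set (k := fun i => pr e z p (y i) / sn e l).
  set (B := fun i => cs e (mdist z (y i)) / 2).
  set (M := lsum (fun i => 2 * mu i * B i + (B i + Rabs (k i)) ^ 2) L).
  assert (2 * lsum (fun i => mu i * k i) L <= 0) as Q.
  (* The parameter is [u = sn e t]: the bound by [sn e l] keeps [t] on the geodesic, and the bound
     by 1 controls [u * B i]. *)
  { apply (linear_le_quadratic _ M (Rmin 1 (sn e l))); [apply Rmin_pos; lra|].
    intros u [hu hu1].
    pose proof (Rmin_l 1 (sn e l)). pose proof (Rmin_r 1 (sn e l)).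
    set (t := asn e u).
    assert (sn e t = u) as Et by (apply sn_asn, he).
    assert (0 <= t) as ht by (apply asn_nonneg; lra).
    assert (t <= l) as htl by (apply (sn_le_inv e); [exact he | lra | lra]).
    specialize (Hmin (g t)).
    enough (penalty e y rho L (g t) <= penalty e y rho L z
      + (1 * (u ^ 2 * M) + - (2 * u) * lsum (fun i => mu i * k i) L)) by lra.
    unfold penalty at 2, M.
    replace (u ^ 2 * lsum _ L) with (u ^ 2 * lsum (fun i => 2 * mu i * B i + (B i + Rabs (k i)) ^ 2) L
      + 0 * lsum (fun i => mu i * k i) L) by ring.
    rewrite <- !lsum_lin. rewrite <- (Rmult_1_l (lsum (fun i => excess _ _ _ z ^ 2) L)).
    rewrite <- (Rmult_1_l (lsum (fun i => 1 * _ + _) L)), <- lsum_lin.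
    apply lsum_le. intros i _.
    pose proof (H z p (y i) g t hg (conj ht htl)) as Hh. fold l in Hh.
    rewrite Et in Hh.
    assert (u * k i <= pr e z (g t) (y i)) as Hk.
    { unfold k. apply (Rmult_le_reg_l (sn e l)); [exact hs|].
      replace (sn e l * (u * (pr e z p (y i) / sn e l))) with (u * pr e z p (y i)) by (field; lra).
      exact Hh. }
    unfold pr, ip in Hk. destruct (geodesic_dist z p g t hg (conj ht htl)) as [Dt _].
    rewrite Dt in Hk.
    pose proof (md_le_sn_sqr e t he) as Hmd. rewrite Et in Hmd.
    pose proof (cs_ge1 e (mdist z (y i)) he) as Hc.
    assert (md e (mdist (g t) (y i)) - rho i
            <= (md e (mdist z (y i)) - rho i) + (u ^ 2 * B i - u * k i)) as HG.
    { unfold B. apply (Rmult_le_compat_r (cs e (mdist z (y i)))) in Hmd; [|lra].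
      unfold cs in *. lra. }
    apply Rmax0_le in HG.
    pose proof (Rmax0_sqr_add (md e (mdist z (y i)) - rho i) (u ^ 2 * B i - u * k i)) as HS.
    fold (excess e (y i) (rho i) (g t)) in HG. fold (excess e (y i) (rho i) z) in HS.
    pose proof (Rmax_l 0 (md e (mdist (g t) (y i)) - rho i)) as HP.
    fold (excess e (y i) (rho i) (g t)) in HP.
    assert (excess e (y i) (rho i) (g t) ^ 2
      <= Rmax 0 (md e (mdist z (y i)) - rho i + (u ^ 2 * B i - u * k i)) ^ 2) as H2
      by (apply pow_incr; lra).
    assert (0 < B i) as hB by (unfold B; lra).
    assert ((u ^ 2 * B i - u * k i) ^ 2 <= u ^ 2 * (B i + Rabs (k i)) ^ 2) as H3.
    { replace ((u ^ 2 * B i - u * k i) ^ 2) with (u ^ 2 * (u * B i - k i) ^ 2) by ring.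
      apply Rmult_le_compat_l; [nra|].
      pose proof (Rle_abs (k i)). pose proof (Rle_abs (- k i)) as Hn. rewrite Rabs_Ropp in Hn.
      assert (0 <= u * B i <= B i) by nra. apply pow_maj_Rabs, Rabs_le. lra. }
    unfold mu. lra. }
  rewrite (lsum_ext _ (fun i => sn e l * (mu i * k i) + 0 * (mu i * k i))).
  - rewrite lsum_lin. nra.
  - intros i _. unfold k, mu. field. lra.
Qed.

(** The hypothesis on weights is nonnegativity of a weighted square with [md] of the distances to
    the base point replaced by [rho]. At the minimizer, the first-order conditions in the directions
    [y j], summed with weights [mu j], give the reverse estimate with the actual values [m] in place
    of [rho]. Hence [Qy <= Q], while the penalty equals [Qy - Q]. *)
Lemma helly_finite e (Y : MetricSpace) {I : Type} (y : I -> Y) (rho : I -> R) D i L :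
  0 <= e -> geodesic_space Y -> hinge e Y Rle -> complete Y ->
  (forall i, 0 <= rho i) ->
  (forall i j, md e (mdist (y i) (y j)) <= D i j) ->
  (forall (w : I -> R) L, (forall i, 0 <= w i) ->
     let Q := lsum (fun i => w i * rho i) L in
     dsum (fun i j => w i * w j * D i j) L <= 2 * lsum w L * Q + e * Q ^ 2) ->
  In i L ->
  exists z, forall i, In i L -> md e (mdist z (y i)) <= rho i.
Proof.
  intros he hY H hc hrho hD hw hi.
  destruct (penalty_minimizer e Y y rho i L he hY H hc hi) as [z Hz].
  exists z.
  set (mu := fun i => excess e (y i) (rho i) z).
  set (m := fun i => md e (mdist z (y i))).
  assert (forall i, 0 <= mu i) as hmu by (intros; apply Rmax_l).
  assert (forall i, 0 <= m i) as hm by (intros; apply md_nonneg, he).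
  set (N := lsum mu L). set (Qy := lsum (fun i => mu i * m i) L).
  set (Q := lsum (fun i => mu i * rho i) L).
  pose proof (hw mu L hmu) as W. cbv zeta in W. fold N Q in W.
  assert (2 * N * Qy + e * Qy ^ 2 <= 2 * N * Q + e * Q ^ 2) as Hcmp.
  { apply (Rle_trans _ (dsum (fun i j => mu i * mu j * D i j) L)); [|exact W].
    replace (2 * N * Qy + e * Qy ^ 2) with ((N + e * Qy) * Qy + Qy * N) by ring.
    unfold Qy at 2. unfold N at 2. rewrite <- lsum_lin. apply lsum_le. intros j _.
    pose proof (penalty_first_order e Y y rho L z (y j) he hY H Hz) as F.
    fold mu in F. change (fun i => excess e (y i) (rho i) z * _) with
      (fun i => mu i * pr e z (y j) (y i)) in F.
    rewrite (lsum_ext _ (fun i => 1 * ((1 + e * m j) * (mu i * m i) + m j * mu i)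
      + -1 * (mu i * md e (mdist (y j) (y i))))) in F.
    2:{ intros k _. unfold pr, ip. fold (m k) (m j). ring. }
    rewrite (lsum_lin (fun i => (1 + e * m j) * (mu i * m i) + m j * mu i)), lsum_lin in F.
    fold N Qy in F.
    apply (Rle_trans _ (mu j * lsum (fun i => mu i * md e (mdist (y j) (y i))) L
                        + 0 * lsum (fun i => 0) L)).
    - pose proof (hmu j). nra.
    - rewrite <- lsum_lin. apply lsum_le. intros k _.
      pose proof (hmu j). pose proof (hmu k).
      pose proof (Rmult_le_compat_l (mu j * mu k) _ _ ltac:(nra) (hD j k)). lra. }
  assert (0 <= Q) as hQ.
  { apply lsum_nonneg. intros k _. pose proof (hmu k). pose proof (hrho k). nra. }
  assert (0 <= N) as hN by (apply lsum_nonneg; auto).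
  (* The square of [mu k] is [mu k * (m k - rho k)], since [mu k] vanishes wherever [m k] is below
     [rho k]. *)
  assert (penalty e y rho L z = Qy - Q) as EP.
  { unfold Qy, Q. replace (lsum (fun i => mu i * m i) L - lsum (fun i => mu i * rho i) L) with
      (1 * lsum (fun i => mu i * m i) L + -1 * lsum (fun i => mu i * rho i) L) by ring.
    rewrite <- lsum_lin. apply lsum_ext. intros k _. unfold mu, m, excess, Rmax.
    destruct (Rle_dec 0 _); ring. }
  assert (forall k, In k L -> mu k <= N) as HN by (intros; apply lsum_term_le; auto).
  assert (forall k, In k L -> mu k = 0 -> m k <= rho k) as Hfin.
  { intros k _ Hk. pose proof (Rmax_r 0 (m k - rho k)) as P.
    change (Rmax 0 (m k - rho k)) with (mu k) in P. lra. }
  intros k hk. apply Hfin; [exact hk|]. pose proof (hmu k). specialize (HN k hk).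
  destruct hN as [hN | <-]; [|lra].
  assert (Qy <= Q).
  { apply Rnot_lt_le. intros Hlt.
    assert (N * Q < N * Qy) by (apply Rmult_lt_compat_l; lra).
    assert (Q ^ 2 <= Qy ^ 2) by (apply pow_incr; lra).
    assert (e * Q ^ 2 <= e * Qy ^ 2) by (apply Rmult_le_compat_l; lra). lra. }
  pose proof (lsum_term_le (fun i => mu i ^ 2) L k (fun _ _ => pow2_ge_0 _) hk) as P.
  change (lsum (fun i => mu i ^ 2) L) with (penalty e y rho L z) in P. simpl in P. nra.
Qed.

(** Balls are closed, bounded and midpoint convex, so weak compactness passes from finite families
    to arbitrary ones. *)
Lemma helly e (Y : MetricSpace) {I : Type} (y : I -> Y) (rho : I -> R) D (i0 : I) :
  0 <= e -> geodesic_space Y -> hinge e Y Rle -> complete Y ->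
  (forall i, 0 <= rho i) ->
  (forall i j, md e (mdist (y i) (y j)) <= D i j) ->
  (forall (w : I -> R) L, (forall i, 0 <= w i) ->
     let Q := lsum (fun i => w i * rho i) L in
     dsum (fun i j => w i * w j * D i j) L <= 2 * lsum w L * Q + e * Q ^ 2) ->
  exists z, forall i, md e (mdist z (y i)) <= rho i.
Proof.
  intros he hY H hc hrho hD hw.
  apply (finite_intersection e Y (fun i z => md e (mdist z (y i)) <= rho i)
    i0 (y i0) (rho i0 + 1)); auto.
  - intros i p Hp.
    destruct (md_surj e (rho i) he (hrho i)) as (r & hr & Er). rewrite <- Er.
    apply md_le; [exact he|]. split; [apply mdist_nonneg|].
    apply le_epsilon. intros eps heps. destruct (Hp eps heps) as (q & q1 & q2).
    rewrite <- Er in q1. apply md_le_inv in q1; [|exact he | exact hr].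
    pose proof (mdist_tri Y p q (y i)). rewrite (mdist_sym Y p q) in *. lra.
  - intros i a b g ha hb hg. simpl in *.
    pose proof (midpoint_md e Y a b (y i) g he H hg).
    pose proof (md_nonneg e (mdist a b / 2) he). lra.
  - intros L.
    destruct (helly_finite e Y y rho D i0 (i0 :: L) he hY H hc hrho hD hw
      (or_introl eq_refl)) as [z Hz].
    exists z. intros i hi. apply Hz. now right.
  - intros z hz. pose proof (md_ge_sqr e (mdist z (y i0)) he (mdist_nonneg _ _)).
    rewrite mdist_sym. pose proof (pow2_ge_0 (mdist z (y i0) - 1)). lra.
Qed.

(** * Double sums and raised distances *)

Lemma dsum_le {T : Type} (f g : T -> T -> R) L : (forall i j, f i j <= g i j) ->
  dsum f L <= dsum g L.
Proof. intros H. apply lsum_le. intros i _. apply lsum_le. auto. Qed.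

Lemma dsum_ext {T : Type} (f g : T -> T -> R) L : (forall i j, f i j = g i j) ->
  dsum f L = dsum g L.
Proof. intros H. apply lsum_ext. intros i _. apply lsum_ext. auto. Qed.

Lemma dsum_plus {T : Type} (f g : T -> T -> R) L :
  dsum (fun i j => f i j + g i j) L = dsum f L + dsum g L.
Proof.
  unfold dsum. rewrite (lsum_ext _ (fun i => 1 * lsum (f i) L + 1 * lsum (g i) L)).
  - rewrite lsum_lin. ring.
  - intros i _. rewrite <- lsum_lin. apply lsum_ext. intros; ring.
Qed.

Lemma lsum_scal {T : Type} (f : T -> R) a L : lsum (fun i => a * f i) L = a * lsum f L.
Proof. induction L as [|i L IH]; simpl; [|rewrite IH]; ring. Qed.

Lemma dsum_scal {T : Type} (f : T -> T -> R) a L :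
  dsum (fun i j => a * f i j) L = a * dsum f L.
Proof.
  unfold dsum. rewrite <- lsum_scal. apply lsum_ext. intros i _. apply lsum_scal.
Qed.

Lemma dsum_prod {T : Type} (f g : T -> R) L :
  dsum (fun i j => f i * g j) L = lsum f L * lsum g L.
Proof.
  unfold dsum. rewrite (lsum_ext _ (fun i => lsum g L * f i)).
  - rewrite lsum_scal. ring.
  - intros i _. rewrite lsum_scal. ring.
Qed.

Lemma dsum_map {T U : Type} (h : U -> T) (f : T -> T -> R) L :
  dsum f (map h L) = dsum (fun i j => f (h i) (h j)) L.
Proof.
  unfold dsum. rewrite lsum_map. apply lsum_ext. intros i _. apply lsum_map.
Qed.

(** Multiplies [1 + e * m], that is [cs] of the distance, by [1 + e * eta]; for [e = 0] it adds
    [eta]. *)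
Definition raise (e eta : R) (b : bool) (m : R) : R :=
  if b then eta + (1 + e * eta) * m else m.

(** Two copies of [X] at height distance [eta]: distances [d] between the copies are replaced
    by the [D] with [md e D = raise e eta true (md e d)]. For [e = 0] this is the metric of
    [X x R]. The inequality that [helly] requires persists, since it holds in [X] for the
    weights of one copy multiplied by [1 + e * eta]. *)
Lemma two_level_sum e eta (X : MetricSpace) (x : X) {I : Type} (p : I -> X) (h : I -> bool)
  (w : I -> R) L :
  0 <= e -> 0 <= eta -> geodesic_space X -> hinge e X Rge -> (forall i, 0 <= w i) ->
  let Q := lsum (fun i => w i * raise e eta (h i) (md e (mdist x (p i)))) L in
  dsum (fun i j => w i * w j * raise e eta (xorb (h i) (h j)) (md e (mdist (p i) (p j)))) L
  <= 2 * lsum w L * Q + e * Q ^ 2.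
Proof.
  intros he heta hX H hw. cbv zeta.
  set (b := fun i => if h i then 1 else 0).
  set (v := fun i => w i * (1 + e * eta * b i)).
  set (m := fun i => md e (mdist x (p i))).
  set (d := fun i j => md e (mdist (p i) (p j))).
  assert (forall i, b i = 0 \/ b i = 1) as hb by (intros i; unfold b; destruct (h i); auto).
  assert (forall i j, 0 <= d i j) as hd by (intros; apply md_nonneg, he).
  assert (0 <= e * eta) as hee by nra.
  pose proof (CBB_sum_nonneg e X x (map (fun i => (v i, p i)) L) he hX H) as S.
  rewrite dsum_map in S. simpl in S.
  rewrite (dsum_ext _ (fun i j => (v i * m i * v j + v i * (v j * m j))
     + (e * (v i * m i) * (v j * m j) + (-1 * (v i * v j * d i j))))) in S.
  2:{ intros i j. unfold pr, ip, m, d. ring. }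
  rewrite !dsum_plus, (dsum_prod (fun i => v i * m i) v), (dsum_prod v (fun i => v i * m i)),
    (dsum_prod (fun i => e * (v i * m i)) (fun i => v i * m i)), lsum_scal in S.
  set (N := lsum w L). set (Hs := lsum (fun i => w i * b i) L).
  set (Qv := lsum (fun i => v i * m i) L) in *.
  assert (lsum v L = N + e * eta * Hs) as EN.
  { unfold N, Hs. rewrite <- lsum_scal, <- (Rmult_1_l (lsum w L)),
      <- (Rmult_1_l (lsum (fun i => e * eta * _) L)), <- lsum_lin.
    apply lsum_ext. intros i _. unfold v. ring. }
  assert (lsum (fun i => w i * raise e eta (h i) (m i)) L = Qv + eta * Hs) as EQ.
  { unfold Qv, Hs. rewrite <- (Rmult_1_l (lsum (fun i => v i * m i) L)), <- lsum_lin.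
    apply lsum_ext. intros i _. unfold v, b, raise. destruct (h i); ring. }
  change (lsum (fun i => w i * raise e eta (h i) (md e (mdist x (p i)))) L) with
    (lsum (fun i => w i * raise e eta (h i) (m i)) L).
  rewrite EQ. rewrite EN in S.
  assert (0 <= (N + e * eta * Hs) * Qv * 2 + e * Qv ^ 2
    - dsum (fun i j => v i * v j * d i j) L) as S'.
  { rewrite (dsum_scal (fun i j => v i * v j * d i j)) in S.
    enough (0 <= Qv * (N + e * eta * Hs) + (N + e * eta * Hs) * Qv
      + (e * Qv * Qv + -1 * dsum (fun i j => v i * v j * d i j) L)) by lra.
    apply S. intros i hi. apply in_map_iff in hi as (j & <- & _). simpl.
    apply Rmult_le_pos; [apply hw|]. destruct (hb j) as [-> | ->]; lra. }
  apply (Rle_trans _ (dsum (fun i j => v i * v j * d i j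
     + (eta * (w i * b i) * (w j * (1 - b j)) + eta * (w i * (1 - b i)) * (w j * b j))) L)).
  (* Termwise this is an equality unless both points are raised, where the right side has the extra
     factor [(1 + e * eta) ^ 2]. *)
  - apply dsum_le. intros i j. pose proof (hw i). pose proof (hw j).
    assert (0 <= w i * w j) as hwij by nra.
    enough (raise e eta (xorb (h i) (h j)) (d i j)
      <= (1 + e * eta * b i) * (1 + e * eta * b j) * d i j
         + eta * (b i * (1 - b j) + (1 - b i) * b j)) as E.
    { apply (Rmult_le_compat_l _ _ _ hwij) in E. unfold v. unfold d in *. lra. }
    pose proof (hd i j). assert (0 <= e * eta * d i j) by nra.
    assert (0 <= e * eta * (e * eta * d i j)) by nra.
    unfold raise, b. destruct (h i), (h j); simpl; lra.
  - rewrite !dsum_plus, (dsum_prod (fun i => eta * (w i * b i)) (fun j => w j * (1 - b j))),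
      (dsum_prod (fun i => eta * (w i * (1 - b i))) (fun j => w j * b j)), !lsum_scal.
    fold Hs.
    assert (lsum (fun i => w i * (1 - b i)) L = N - Hs) as ->.
    { unfold N, Hs. replace (lsum w L - lsum (fun i => w i * b i) L) with
        (1 * lsum w L + -1 * lsum (fun i => w i * b i) L) by ring.
      rewrite <- lsum_lin. apply lsum_ext. intros; ring. }
    assert (0 <= e * eta ^ 2 * Hs ^ 2 + 2 * eta * Hs ^ 2); [|lra].
    pose proof (pow2_ge_0 Hs). pose proof (pow2_ge_0 eta).
    assert (0 <= eta * Hs ^ 2) by nra. assert (0 <= e * eta ^ 2) by nra.
    assert (0 <= e * eta ^ 2 * Hs ^ 2) by nra. lra.
Qed.

(** [G] is the graph of a nonexpansive partial map, placed at height [eta] above the map [F]. *)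
Definition compatible e eta {X Y : MetricSpace} (F : X -> Y) (G : X * Y -> Prop) : Prop :=
  (forall p q, G p -> G q -> mdist (snd p) (snd q) <= mdist (fst p) (fst q)) /\
  (forall p z, G p ->
     md e (mdist (snd p) (F z)) <= raise e eta true (md e (mdist (fst p) z))).

(** * Extension of maps close to a given one *)

Lemma one_point_extension e eta (X Y : MetricSpace) (F : X -> Y) G x :
  0 <= e -> 0 <= eta -> geodesic_space X -> hinge e X Rge ->
  geodesic_space Y -> hinge e Y Rle -> complete Y ->
  nonexpansive mdist F -> compatible e eta F G ->
  exists y, compatible e eta F (fun p => G p \/ p = (x, y)).
Proof.
  intros he heta hX HX hY HY hc hF [HG1 HG2].
  (* One ball for each point of [G] on the lower level, where [x] lies, and one for each value of
     [F] on the raised level; a common point is the new value at [x]. *)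
  set (I := ({p : X * Y | G p} + X)%type).
  set (px := fun i : I => match i with inl p => fst (proj1_sig p) | inr z => z end).
  set (py := fun i : I => match i with inl p => snd (proj1_sig p) | inr z => F z end).
  set (h := fun i : I => match i with inl _ => false | inr _ => true end).
  destruct (helly e Y py (fun i => raise e eta (h i) (md e (mdist x (px i))))
    (fun i j => raise e eta (xorb (h i) (h j)) (md e (mdist (px i) (px j)))) (inr x))
    as [y Hy]; auto.
  - intros i. pose proof (md_nonneg e (mdist x (px i)) he).
    assert (0 <= e * eta) by nra. unfold raise. destruct (h i); nra.
  - intros [[p hp] | z] [[q hq] | z']; simpl.
    + apply md_le; [exact he|]. split; [apply mdist_nonneg | now apply HG1].
    + now apply HG2.
    + rewrite mdist_sym, (mdist_sym X z). now apply HG2.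
    + apply md_le; [exact he|]. split; [apply mdist_nonneg | apply hF].
  - intros w L hw. now apply two_level_sum.
  - exists y.
    assert (forall p, G p -> mdist y (snd p) <= mdist x (fst p)) as H1.
    { intros p hp. apply (md_le_inv e); [exact he | apply mdist_nonneg|].
      exact (Hy (inl (exist _ p hp))). }
    split.
    + intros p q [hp | ->] [hq | ->]; simpl.
      * now apply HG1.
      * rewrite mdist_sym, (mdist_sym X). now apply H1.
      * now apply H1.
      * rewrite !mdist_self. lra.
    + intros p z [hp | ->]; [now apply HG2 | exact (Hy (inr z))].
Qed.

Lemma zorn_union (T : Type) (P : (T -> Prop) -> Prop) :
  (forall F : (T -> Prop) -> Prop, (forall S, F S -> P S) ->
     (forall S S', F S -> F S' -> (forall x, S x -> S' x) \/ (forall x, S' x -> S x)) ->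
     P (fun x => exists S, F S /\ S x)) ->
  exists A, P A /\
    forall B : T -> Prop, (forall x, A x -> B x) -> P B -> forall x, B x -> A x.
Proof.
  intros H. destruct (@classical_sets.Zorn_bigcup T P) as [A [HA HM]].
  - intros F HF Ht. specialize (H F HF Ht).
    replace (classical_sets.bigcup F _) with (fun x => exists S, F S /\ S x); [exact H|].
    apply boolp.funext. intros x. apply boolp.propext.
    split; [intros (S & a & b) | intros [S a b]]; exists S; auto.
  - exists A. split; [exact HA|]. intros B h hP x hx. apply Classical_Prop.NNPP. intros N.
    apply (HM B); [|exact hP]. split; [exact h|]. intros Q. apply N, Q, hx.
Qed.

Lemma extension_near e eta (X Y : MetricSpace) (F : X -> Y) G0 :
  0 <= e -> 0 <= eta -> geodesic_space X -> hinge e X Rge ->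
  geodesic_space Y -> hinge e Y Rle -> complete Y ->
  nonexpansive mdist F -> compatible e eta F G0 ->
  exists g : X -> Y, nonexpansive mdist g /\ (forall p, G0 p -> g (fst p) = snd p) /\
    forall x, md e (mdist (g x) (F x)) <= eta.
Proof.
  intros he heta hX HX hY HY hc hF HG0.
  (* Adjoining [G0] within the property makes the union of the empty chain admissible. *)
  destruct (zorn_union (X * Y) (fun A => compatible e eta F (fun p => A p \/ G0 p)))
    as [A [HA HM]].
  { intros C HC Ht. split.
    - intros p q [(S & hS & hp) | hp] [(S' & hS' & hq) | hq].
      + destruct (Ht S S' hS hS') as [Hs | Hs].
        * apply (HC S' hS'); left; auto.
        * apply (HC S hS); left; auto.
      + apply (HC S hS); auto.
      + apply (HC S' hS'); auto.
      + now apply HG0.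
    - intros p z [(S & hS & hp) | hp]; [apply (HC S hS); auto | now apply HG0]. }
  assert (forall x, exists y, A (x, y)) as Htot.
  { intros x.
    destruct (one_point_extension e eta X Y F _ x he heta hX HX hY HY hc hF HA) as [y Hy].
    exists y. apply (HM (fun p => A p \/ p = (x, y))); [tauto | | now right].
    destruct Hy as [H1 H2]. split.
    - intros p q hp hq. apply H1; tauto.
    - intros p z hp. apply H2; tauto. }
  destruct (functional_choice (fun x y => A (x, y)) Htot) as [g hg].
  destruct HA as [HA1 HA2]. exists g. split; [|split].
  - intros s t. apply (HA1 (s, g s) (t, g t)); auto.
  - intros p hp. apply mdist_eq0.
    pose proof (HA1 (fst p, g (fst p)) p (or_introl (hg _)) (or_intror hp)) as Q.
    simpl in Q. rewrite mdist_self in Q. pose proof (mdist_nonneg (g (fst p)) (snd p)). lra.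
  - intros x. pose proof (HA2 (x, g x) x (or_introl (hg x))) as Q. simpl in Q.
    rewrite mdist_self, md_0 in Q. lra.
Qed.

(** * The supremum metric and lower semi-continuity *)

Lemma dsup_le {T : Type} {dT : T -> T -> R} {Y : MetricSpace} (f g : Nmap dT Y) c : 0 <= c ->
  (forall t, mdist (proj1_sig f t) (proj1_sig g t) <= c) -> dsup f g <= c.
Proof.
  intros hc H. unfold dsup.
  set (E := fun r => exists t : T, r = mdist (proj1_sig f t) (proj1_sig g t)).
  destruct (Lub_Rbar_correct E) as [_ H2].
  assert (Rbar_le (Lub_Rbar E) c) as Q by (apply H2; intros r [t ->]; apply H).
  (* For empty [T] the least upper bound is minus infinity, which [real] sends to 0; this case uses
     [0 <= c]. *)
  destruct (Lub_Rbar E); simpl in *; lra.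
Qed.

(** Boundedness of both maps makes the least upper bound finite, so that [real] does not replace it
    by 0. *)
Lemma mdist_le_dsup {T : Type} {dT : T -> T -> R} {Y : MetricSpace} (f g : Nmap dT Y) t :
  mdist (proj1_sig f t) (proj1_sig g t) <= dsup f g.
Proof.
  unfold dsup. set (E := fun r => exists t : T, r = mdist (proj1_sig f t) (proj1_sig g t)).
  destruct (Lub_Rbar_correct E) as [H1 H2].
  destruct (proj2 (proj2_sig f)) as [Bf hBf]. destruct (proj2 (proj2_sig g)) as [Bg hBg].
  assert (Rbar_le (Lub_Rbar E) (Bf + mdist (proj1_sig f t) (proj1_sig g t) + Bg)) as Q.
  { apply H2. intros r [s ->]. simpl.
    pose proof (hBf s t). pose proof (hBg t s).
    pose proof (mdist_tri Y (proj1_sig f s) (proj1_sig f t) (proj1_sig g s)).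
    pose proof (mdist_tri Y (proj1_sig f t) (proj1_sig g t) (proj1_sig g s)). lra. }
  assert (Rbar_le (mdist (proj1_sig f t) (proj1_sig g t)) (Lub_Rbar E)) as Q2 by (apply H1; now exists t).
  destruct (Lub_Rbar E); simpl in *; [exact Q2 | contradiction | contradiction].
Qed.

Lemma md_uniform e D eta : 0 <= e -> 0 <= D -> 0 < eta ->
  exists del, 0 < del /\ forall t, 0 <= t <= D -> md e (t + del) <= eta + md e t.
Proof.
  intros he hD heta.
  pose proof (sn_nonneg e D he hD) as hs. pose proof (cs_ge1 e D he) as hc.
  set (K := sn e D + cs e D).
  assert (0 < eta / K) as P by (apply Rdiv_lt_0_compat; unfold K; lra).
  (* With [del = asn e u] the increment of [md] is [md e del * cs e t + sn e t * u], at most [u * K]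
     because [u <= 1]. *)
  set (u := Rmin 1 (eta / K)).
  assert (0 < u) as hu by (apply Rmin_pos; lra).
  assert (u <= 1) as hu1 by apply Rmin_l.
  assert (u * K <= eta) as huK.
  { assert (u <= eta / K) as Q by apply Rmin_r. apply Rle_div_r in Q; [exact Q|].
    unfold K; lra. }
  exists (asn e u).
  pose proof (asn_nonneg e u he ltac:(lra)) as ha. pose proof (sn_asn e u he) as Es.
  split.
  { destruct ha as [|Z]; [assumption|]. rewrite <- Z, sn_0 in Es. lra. }
  intros t ht. rewrite md_plus, Es by exact he.
  pose proof (md_le_sn_sqr e (asn e u) he) as Hm. rewrite Es in Hm.
  pose proof (md_nonneg e (asn e u) he) as hm0.
  pose proof (md_le e t D he ht) as Hmt. pose proof (sn_le e t D he ht) as Hst.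
  assert (cs e t <= cs e D) as Hct by (unfold cs; nra).
  pose proof (cs_ge1 e t he).
  assert (md e (asn e u) * cs e t <= u * cs e D) by (apply Rmult_le_compat; nra).
  assert (sn e t * u <= sn e D * u) by (apply Rmult_le_compat_r; lra).
  unfold K, cs in *. lra.
Qed.

Theorem theorem3p3 (k : R) (X Y : MetricSpace) (A : X -> Prop) :
  k <= 0 -> CBB k X -> CAT k Y -> complete Y -> (exists a, A a) ->
  lower_semicontinuous (@dsup (sub X A) (dsub A) Y) (@dsup X (@mdist X) Y) (@Phi X Y A).
Proof.
  intros hk hX hY hc _ V hV f (F & hFf & hVF).
  assert (0 <= - k) as he by lra.
  pose proof (hinge_CBB k X hk hX) as HX. pose proof (hinge_CAT k Y hk hY) as HY.
  destruct hX as [hX _]. destruct hY as [hY _].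
  set (e := - k) in *. clearbody e.
  destruct (hV F hVF) as (eps & heps & Heps).
  destruct (proj2_sig F) as [hF1 [B hB]].
  (* Distances between values of [F] stay in the interval from 0 to [D], where [md] is uniformly
     continuous. *)
  set (D := Rmax 0 B). pose proof (Rmax_l 0 B : 0 <= D) as hD.
  pose proof (Rmax_r 0 B : B <= D) as hBD.
  (* Since [md] dominates half the square, a value of [md] at most [eta] forces a distance at most
     [eps / 2]. *)
  set (eta := (eps / 2) ^ 2 / 2). assert (0 < eta) as heta by (unfold eta; nra).
  destruct (md_uniform e D eta he hD heta) as (del & hdel & Hdel).
  exists del. split; [exact hdel|]. intros g hg.
  destruct (extension_near e eta X Y (proj1_sig F)
    (fun p => exists a : sub X A, p = (proj1_sig a, proj1_sig g a)))
    as (G & hG1 & hG2 & hG3); auto; try lra.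
  { split.
    - intros p q [a ->] [b ->]. simpl. apply (proj1 (proj2_sig g)).
    (* The value [g a] is within [del] of [F a], so replacing one by the other raises [md] of the
       distance to [F z] by at most [eta]. *)
    - intros p z [a ->]. unfold raise. simpl.
      set (fa := proj1_sig F (proj1_sig a)). set (fz := proj1_sig F z).
      pose proof (hF1 (proj1_sig a) z : mdist fa fz <= _) as N1.
      pose proof (hB (proj1_sig a) z : mdist fa fz <= B) as N2.
      pose proof (mdist_le_dsup f g a) as N3. rewrite <- (hFf a) in N3. fold fa in N3.
      pose proof (mdist_tri Y (proj1_sig g a) fa fz) as N4.
      rewrite (mdist_sym Y (proj1_sig g a) fa) in N4.
      pose proof (mdist_nonneg fa fz) as N5.
      assert (mdist (proj1_sig g a) fz <= mdist fa fz + del) as N6 by lra.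
      pose proof (md_le e _ _ he (conj (mdist_nonneg (proj1_sig g a) fz) N6)) as M1.
      pose proof (Hdel (mdist fa fz) (conj N5 (Rle_trans _ _ _ N2 hBD))) as M2.
      pose proof (md_le e _ _ he (conj N5 N1)) as M3.
      pose proof (md_nonneg e (mdist (proj1_sig a) z) he).
      assert (0 <= e * eta * md e (mdist (proj1_sig a) z)) by (apply Rmult_le_pos; nra). lra. }
  assert (forall x, mdist (proj1_sig F x) (G x) <= eps / 2) as Hclose.
  { intros x. rewrite mdist_sym. pose proof (hG3 x) as Q.
    pose proof (md_ge_sqr e (mdist (G x) (proj1_sig F x)) he (mdist_nonneg _ _)).
    pose proof (mdist_nonneg (G x) (proj1_sig F x)). unfold eta in Q. nra. }
  assert (nonexpansive mdist G /\ bounded_map G) as hG.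
  { split; [exact hG1|]. exists (eps / 2 + B + eps / 2). intros s t.
    pose proof (hB s t). pose proof (Hclose s). pose proof (Hclose t).
    pose proof (mdist_tri Y (G s) (proj1_sig F s) (G t)).
    pose proof (mdist_tri Y (proj1_sig F s) (proj1_sig F t) (G t)).
    rewrite (mdist_sym Y (G s) (proj1_sig F s)) in *. lra. }
  exists (exist _ G hG). split.
  - intros a. apply (hG2 (proj1_sig a, proj1_sig g a)). now exists a.
  - apply Heps.
    (* The pointwise bound passes to the supremum only as a weak inequality; [eps / 2] leaves room
       for the strict one. *)
    pose proof (dsup_le F (exist _ G hG) (eps / 2) ltac:(lra) Hclose). lra.
Qed.
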